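(* Let $M=(S,\mathcal{B})$ be a split matroid, let $k\geq 1$ be an integer, and let $S=B_1\cup\dots\cup B_k$ be a partition of the ground set into $k$ pairwise disjoint bases of $M$. Then $M$ has a cyclic ordering in which the elements of $B_i$ form an interval for each $i\in\{1,\dots,k\}$. That is, writing $r$ for the rank of $M$ and $n=|S|$, there is an ordering $S=\{s_1,\dots,s_n\}$ of the elements of $S$ such that $\{s_i,s_{i+1},\dots,s_{i+r-1}\}\in\mathcal{B}$ for every $i\in\{1,\dots,n\}$ (indices understood cyclically, i.e. modulo $n$), and such that for each $i\in\{1,\dots,k\}$ the elements of $B_i$ occupy cyclically consecutive positions in this ordering.
   Context: Matroids are finite and written $M=(S,\mathcal{B})$, where $S$ is the ground set and $\mathcal{B}$ is the family of bases. Cyclic ordering: for a rank-$r$ matroid $M=(S,\mathcal{B})$ with $|S|=n$, a cyclic ordering of $M$ is an ordering $S=\{s_1,\dots,s_n\}$ of its elements such that $\{s_i,s_{i+1},\dots,s_{i+r-1}\}\in\mathcal{B}$ for every $i\in\{1,\dots,n\}$, where indices are understood in a cyclic order (modulo $n$). An interval of the ordering is a set of cyclically consecutive elements. Elementary split matroid: let $S$ be a finite ground set of size at least $r$, let $\mathcal{H}=\{H_1,\dots,H_q\}$ be a (possibly empty) collection of subsets of $S$, and let $r,r_1,\dots,r_q$ be nonnegative integers satisfying $|H_i\cap H_j|\leq r_i+r_j-r$ for all distinct $i,j\in\{1,\dots,q\}$, and $|S-H_i|+r_i\geq r$ for all $i\in\{1,\dots,q\}$. The corresponding elementary split matroid is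 the matroid on $S$ whose family of bases is $\mathcal{B}=\{X\subseteq S : |X|=r,\ |X\cap H_i|\leq r_i \text{ for all } i\in\{1,\dots,q\}\}$ (it is known that this family is indeed the family of bases of a rank-$r$ matroid). Split matroid: a split matroid is a direct sum of a single elementary split matroid and some (possibly zero) uniform matroids. *)

(* Defs.v *)
From mathcomp Require Import all_boot.

Set Implicit Arguments.
Unset Strict Implicit.
Unset Printing Implicit Defensive.

(* The ground set is a subset of the ambient type [T], so that direct sums can
   be formed internally, over disjoint subsets of the same type. *)
Record matroid (T : finType) := Matroid {
  ground : {set T};
  bases : {set {set T}};
  bases_sub_ground : forall X, X \in bases -> X \subset ground;
  bases_neq0 : bases != set0;
  basis_exchange : forall X Y x, X \in bases -> Y \in bases ->
    x \in X :\: Y -> exists2 y, y \in Y :\: X & y |: (X :\ x) \in bases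
}.

(* All bases have the same size, see [card_basis]. *)
Definition rank (T : finType) (M : matroid T) : nat :=
  \max_(X in bases M) #|X|.

Lemma leq_card_bases (T : finType) (M : matroid T) (X Y : {set T}) :
  X \in bases M -> Y \in bases M -> #|X| <= #|Y|.
Proof.
move=> + YM; have [m] := ubnP #|X :\: Y|.
elim: m X => // m IHm X ltXm XM.
have [XY0|[x xXY]] := set_0Vmem (X :\: Y).
  by apply: subset_leq_card; rewrite -setD_eq0 XY0.
have [y yYX X'M] := basis_exchange XM YM xXY.
move: (xXY) yYX; rewrite !inE => /andP[xY xX] /andP[yX yY].
have cardX' : #|y |: (X :\ x)| = #|X|.
  by rewrite cardsU1 !inE (negPf yX) andbF (cardsD1 x X) xX.
rewrite -cardX'; apply: IHm X'M.
apply: leq_trans (ltXm : #|X :\: Y| <= m).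
apply: proper_card; apply/properP; split.
  apply/subsetP => z; rewrite !inE => /andP[zY /orP[/eqP zy|/andP[_ zX]]].
    by rewrite zy yY in zY.
  by rewrite zY zX.
exists x; rewrite // !inE xY eqxx orbF /=.
by apply: contraNneq xY => ->; rewrite yY.
Qed.

Lemma card_basis (T : finType) (M : matroid T) (X : {set T}) :
  X \in bases M -> #|X| = rank M.
Proof.
move=> XM; apply/eqP; rewrite eqn_leq; apply/andP; split.
  exact: (leq_bigmax_cond (F := fun Y : {set T} => #|Y|)).
by apply/bigmax_leqP => Y YM; apply: (leq_card_bases YM XM).
Qed.

Definition uniform (T : finType) (M : matroid T) : Prop :=
  exists2 r, r <= #|ground M| &
    bases M = [set X : {set T} | X \subset ground M & #|X| == r].

(* The intersection bound is |H i :&: H j| <= h i + h j - r over the integers;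
   [r] is moved to the left-hand side to avoid truncated subtraction. *)
Definition elementary_split (T : finType) (M : matroid T) : Prop :=
  exists (r q : nat) (H : 'I_q -> {set T}) (h : 'I_q -> nat),
    [/\ r <= #|ground M|,
        forall i, H i \subset ground M,
        forall i j, i != j -> #|H i :&: H j| + r <= h i + h j,
        forall i, r <= #|ground M :\: H i| + h i &
        bases M = [set X : {set T} | [&& X \subset ground M, #|X| == r &
                                         [forall i, #|X :&: H i| <= h i]]]].

Definition direct_sum (T : finType) (m : nat) (N : 'I_m -> matroid T)
    (M : matroid T) : Prop :=
  [/\ forall i j, i != j -> [disjoint ground (N i) & ground (N j)],
      ground M = \bigcup_i ground (N i) &
      bases M = [set \bigcup_i F i | F : {ffun 'I_m -> {set T}}
                                   & [forall i, F i \in bases (N i)]]].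

Definition split_matroid (T : finType) (M : matroid T) : Prop :=
  exists (m : nat) (N : 'I_m.+1 -> matroid T),
    [/\ elementary_split (N ord0),
        forall i, i != ord0 -> uniform (N i) &
        direct_sum N M].

(* The [l] cyclically consecutive entries of [s] starting at position [i]
   (provided [l <= size s]). *)
Definition cyclic_segment (T : finType) (s : seq T) (i l : nat) : {set T} :=
  [set x in take l (rot i s)].

Definition cyclic_interval (T : finType) (s : seq T) (A : {set T}) : Prop :=
  exists i l : nat, A = cyclic_segment s i l.

Definition cyclic_ordering (T : finType) (M : matroid T) (s : seq T) : Prop :=
  [/\ uniq s, s =i ground M &
      forall i, i < size s -> cyclic_segment s i (rank M) \in bases M].

(* Main.v *)
Require Import Defs.
From mathcomp Require Import all_boot.
From mathcomp Require Import zify.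

(** Fix an order of every basis.  The windows between consecutive bases B_t and
    B_(t+1) arise from B_t by exchanging one element after another, and this
    can be read for all t at once: if P_t is the part of B_t that has not yet
    been left behind and W_t is the current window, then a step picks one x_t
    in every P_t and replaces each W_t by W_t - x_t + x_(t+1).  A step is thus
    a closed walk x_0, x_1, ..., x_k = x_0 through the sets P_t that avoids the
    bad pairs, those whose exchange turns W_t into a non-basis.  (For k = 1 every
    order works, so let k > 1.)

    Let M be elementary split, given by sets H_i with bounds h_i.  Since
    |H_i :&: H_j| <= h_i + h_j - r, two sets H_i, H_j that both meet a basis W
    in the maximal number of elements (are tight on W) cover W, and their
    intersection lies inside W.  Hence the bad pairs of W_t form a disjoint
    union of complete bipartite graphs A x D ([bad_block]), and
    |A| + |D| <= |P_t| because B_(t+1) is a basis too ([stage_link]).  So a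
    nonempty set of vertices never has fewer good successors than elements
    ([leq_card_succs]), and a closed walk can only be missing if the bad pairs
    between any two consecutive sets P_t, P_(t+1) consist of two complete
    bipartite graphs that split both sets in two parts, with a twist around
    the cycle.  One link without such a splitting is thus enough for a closed
    walk, and [closed_walk_or_near_split] proves this for the last link.

    This obstruction can really occur after some unlucky steps, so the steps
    need foresight: the invariant is that the last of the k links does not
    split in this way.  Call (x, y) a conflict if exchanging x for y across the
    last link makes it split.  Two tight sets of the basis that is being
    approached witness a conflict, and as distinct tight sets miss disjoint
    parts of a basis, conflicts are rare.  Either they all have the same x, or
    they all have the same y, or |P_t| = 3 and three tight sets determine
    everything ([three_lines]).  In the first two cases some closed walk avoids
    the one forbidden element, in the third the last link has no bad pairs at
    all and the conflicts form a partial matching, which is easily avoided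
    ([reach_two]).  This is [conflict_free_walk]; iterating it gives
    [exchange_orders].

    It remains to start.  If some link does not split initially, the bases are
    renumbered cyclically to make it the last one.  If all of them split, then
    some H_i is tight on every B_t ([common_tight]), and it suffices to list
    the elements of H_i first in every B_t: all windows then meet H_i in
    exactly h_i elements, which already makes them bases ([fits_of_tight]).
    Together this is [split_orders].

    Finally, in a direct sum the orders of the parts of B_t in the various
    components are concatenated.  As these parts have sizes independent of t, a
    window of the concatenation restricts to a window in every component
    ([filter_window_blocks]), and in a uniform component every window is a
    basis. *)

Set Implicit Arguments.
Unset Strict Implicit.
Unset Printing Implicit Defensive.

(** * Closed walks avoiding bad pairs *)

Section Links.

Variable T : finType.
Implicit Types (X Y S U D : {set T}) (b : rel T).

(** Here [b] is a relation of bad pairs, so successors are the elements that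
    some element of [S] is not bad with. *)
Definition succs (b : rel T) (Y S : {set T}) : {set T} :=
  [set y in Y | [exists x in S, ~~ b x y]].

(** The relation [b] between two sets of size [p] is a disjoint union of
    complete bipartite graphs ([link_rect]), each with at most [p] vertices
    ([link_card]); both conditions are symmetric in the two sides. *)
Record link (p : nat) (X Y : {set T}) (b : rel T) : Prop := Link {
  link_src : #|X| = p;
  link_dst : #|Y| = p;
  link_rect : forall x x' y y', x \in X -> x' \in X -> y \in Y -> y' \in Y ->
    b x y -> b x y' -> b x' y -> b x' y';
  link_card : forall x y, x \in X -> y \in Y -> b x y ->
    #|[set x' in X | b x' y]| + #|[set y' in Y | b x y']| <= p
}.

(** The obstruction to closed walks: good pairs only lead from [A] to [C] and
    from the rest of [X] to the rest of [Y]. *)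
Definition splits (X Y : {set T}) (b : rel T) : bool :=
  [exists A : {set T}, exists C : {set T},
    [&& A \subset X, A != set0, A != X, C \subset Y, #|A| == #|C| &
        [forall x in X, forall y in Y, b x y == (x \in A) (+) (y \in C)]]].

Lemma splitsP X Y b :
  reflect (exists A C : {set T}, [/\ A \subset X, A != set0, A != X &
     [/\ C \subset Y, #|A| = #|C| & {in X & Y, forall x y,
          b x y = (x \in A) (+) (y \in C)}]])
    (splits X Y b).
Proof.
apply: (iffP existsP) => [[A /existsP[C]]|[A [C [AX A0 AneX [CY AC bE]]]]].
  case/and5P=> AX A0 AneX CY /andP[/eqP AC /forall_inP bE].
  exists A, C; split=> //; split=> // x y xX yY.
  by have /forall_inP/(_ _ yY)/eqP := bE _ xX.
exists A; apply/existsP; exists C; rewrite AX A0 AneX CY AC eqxx /=.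
by apply/forall_inP => x xX; apply/forall_inP => y yY; rewrite bE.
Qed.

(** What remains of [splits] when only the elements of [U] are known to be bad
    with something. *)
Definition near_split (X Y U : {set T}) (b : rel T) : Prop :=
  exists S D1 D2, [/\ [/\ S \subset X, S != set0 & S != X],
    [/\ D1 \subset Y, D2 \subset Y, D1 != set0, D2 != set0 &
        [disjoint D1 & D2]],
    U \subset D1 :|: D2 &
    {in X & Y, forall x y, b x y = if x \in S then y \in D1 else y \in D2}].

Section OneLink.
Variables (p : nat) (X Y : {set T}) (b : rel T).
Hypothesis L : link p X Y b.

Lemma link_rev : link p Y X (fun y x => b x y).
Proof.
case: L => pX pY rect card_le; split=> //.
  by move=> y y' x x' yY y'Y xX x'X bxy bx'y bxy'; apply: (rect x x' y y').
by move=> y x yY xX bxy; rewrite addnC; apply: card_le.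
Qed.

(** If some [y] is not a successor, then all of [S] lies in its bipartite
    component, whose other side contains every non-successor; the bound on the
    size of the component is the claim. *)
Lemma leq_card_succs S : S \subset X -> S != set0 -> #|S| <= #|succs b Y S|.
Proof.
move=> SX /set0Pn[s sS].
have sX : s \in X := subsetP SX s sS.
have [imY|] := boolP (Y \subset succs b Y S).
  have -> : succs b Y S = Y.
    by apply/eqP; rewrite eqEsubset imY andbT; apply/subsetP => y /setIdP[].
  by rewrite (link_dst L) -(link_src L) subset_leq_card.
case/subsetPn=> y yY ynI.
have bad_y x : x \in S -> b x y.
  move=> xS; apply: contraR ynI => nb; rewrite inE yY /=.
  by apply/exists_inP; exists x.
have := link_card L sX yY (bad_y _ sS).
have : #|S| <= #|[set x' in X | b x' y]|.
  apply: subset_leq_card; apply/subsetP => x xS.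
  by rewrite inE (subsetP SX) ?bad_y.
have : #|Y :\: succs b Y S| <= #|[set y' in Y | b s y']|.
  apply: subset_leq_card; apply/subsetP => z; rewrite !inE => /andP[+ zY].
  rewrite zY /=; apply: contraR => nb.
  by apply/exists_inP; exists s.
have : #|succs b Y S| + #|Y :\: succs b Y S| = p.
  rewrite -(link_dst L) -(cardsID (succs b Y S) Y); congr (_ + _).
  by congr #|pred_of_set _|; apply/setP => z; rewrite !inE; case: (z \in Y).
lia.
Qed.

Lemma succs_sub S : succs b Y S \subset Y.
Proof. by apply/subsetP => y /setIdP[]. Qed.

Lemma succs_full : X != set0 -> succs b Y X = Y.
Proof.
move=> X0; apply/eqP; rewrite eqEcard succs_sub.
by have := leq_card_succs (subxx X) X0; rewrite (link_src L) (link_dst L).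
Qed.

Lemma succsU S1 S2 : succs b Y (S1 :|: S2) = succs b Y S1 :|: succs b Y S2.
Proof.
apply/setP => y; rewrite !inE -andb_orr; congr (_ && _).
apply/exists_inP/orP => [[x /setUP[] xS nb]|[] /exists_inP[x xS nb]].
- by left; apply/exists_inP; exists x.
- by right; apply/exists_inP; exists x.
- by exists x; rewrite // inE xS.
- by exists x; rewrite // inE xS orbT.
Qed.

Lemma not_succsP S y : y \in Y ->
  reflect {in S, forall s, b s y} (y \notin succs b Y S).
Proof.
move=> yY; rewrite inE yY /=; apply: (iffP idP) => [nex s sS|bS].
  by apply: contraR nex => nb; apply/exists_inP; exists s.
by apply/exists_inP => -[s sS]; rewrite bS.
Qed.

(** A non-successor common to [x] and [y] puts both in the same component. *)
Lemma succs1_cover x y : x \in X -> y \in X ->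
  succs b Y [set x] = succs b Y [set y] \/
  succs b Y [set x] :|: succs b Y [set y] = Y.
Proof.
move=> xX yX.
have [YU|] := boolP (Y \subset succs b Y [set x] :|: succs b Y [set y]).
  by right; apply/eqP; rewrite eqEsubset YU subUset !succs_sub.
case/subsetPn=> z zY; rewrite inE negb_or => /andP[].
move=> /(not_succsP _ zY)/(_ x (set11 x)) bxz.
move=> /(not_succsP _ zY)/(_ y (set11 y)) byz.
have im1 u v : v \in Y -> (v \in succs b Y [set u]) = ~~ b u v.
  move=> vY; rewrite inE vY /=; apply/exists_inP/idP => [[w /set1P->]//|nb].
  by exists u; rewrite ?set11.
left; apply/setP => v; have [vY|vnY] := boolP (v \in Y); last first.
  by rewrite !inE (negPf vnY).
rewrite !im1 //; congr (~~ _); apply/idP/idP => bv.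
  exact: (link_rect L xX yX zY vY bxz bv byz).
exact: (link_rect L yX xX zY vY byz bv bxz).
Qed.

(** A common element of [S1] and [S2] would merge the components that miss
    successors of [S1] and of [S2], and some element of [Y] would have no
    predecessor at all. *)
Lemma cover_disjoint S1 S2 : S1 :|: S2 = X ->
  succs b Y S1 != Y -> succs b Y S2 != Y -> [disjoint S1 & S2].
Proof.
move=> S12 nf1 nf2.
have missing S : succs b Y S != Y -> exists2 y, y \in Y & {in S, forall s, b s y}.
  rewrite eqEsubset succs_sub /= => /subsetPn[y yY].
  by move/(not_succsP _ yY) => ?; exists y.
have [y1 y1Y b1] := missing _ nf1; have [y2 y2Y b2] := missing _ nf2.
rewrite -setI_eq0; apply: contraT => /set0Pn[s /setIP[s1 s2]].
have sX : s \in X by rewrite -S12 inE s1.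
have X0 : X != set0 by apply/set0Pn; exists s.
have := y1Y; rewrite -{1}(succs_full X0) -S12 succsU inE.
suff /andP[/negPf-> /negPf->] :
  (y1 \notin succs b Y S1) && (y1 \notin succs b Y S2) by [].
apply/andP; split; apply/(not_succsP _ y1Y) => // t tS.
have tX : t \in X by rewrite -S12 inE tS orbT.
exact: (link_rect L sX tX y2Y y1Y (b2 _ s2) (b1 _ s1) (b2 _ tS)).
Qed.

Lemma cover_succs_b S1 S2 x y : S1 :|: S2 = X -> succs b Y S1 != Y ->
  x \in S1 -> y \in Y -> b x y = (y \notin succs b Y S1).
Proof.
move=> S12; rewrite eqEsubset succs_sub /= => /subsetPn[z zY].
move/(not_succsP _ zY) => bz xS yY.
have sub s : s \in S1 -> s \in X by move=> sS; rewrite -S12 inE sS.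
apply/idP/(not_succsP _ yY) => [bxy s sS|/(_ _ xS)//].
exact: (link_rect L (sub _ xS) (sub _ sS) zY yY (bz _ xS) bxy (bz _ sS)).
Qed.

(** When [U] is everything, comparing [S] and its complement with their
    successor sets forces equality in [leq_card_succs]. *)
Lemma near_split_splits : near_split X Y Y b -> splits X Y b.
Proof.
case=> S [D1 [D2 [[SX S0 SneX] [D1Y D2Y D10 D20 dD] YD bE]]].
have DC y : y \in Y -> (y \in D1) = (y \notin D2).
  move=> yY; have /subsetP/(_ _ yY) := YD; rewrite inE.
  case: (boolP (y \in D1)) => [yD1 _|_ /= -> //].
  by rewrite (disjointFr dD yD1).
have imS : succs b Y S \subset D2.
  apply/subsetP => y /setIdP[yY /exists_inP[x xS]].
  by rewrite bE ?(subsetP SX) // xS DC // negbK.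
have imS' : succs b Y (X :\: S) \subset D1.
  apply/subsetP => y /setIdP[yY /exists_inP[x /setDP[xX xS]]].
  by rewrite bE // (negPf xS) DC // => ->.
have D12 : #|D1| + #|D2| = #|Y|.
  rewrite -cardsUI; have := dD; rewrite -setI_eq0 => /eqP ->.
  rewrite cards0 addn0; congr #|pred_of_set _|.
  by apply/eqP; rewrite eqEsubset YD subUset D1Y D2Y.
have SS : #|S| + #|X :\: S| = #|X|.
  by rewrite -(cardsID S X); congr (_ + _); rewrite (setIidPr SX).
have c1 := leq_trans (leq_card_succs SX S0) (subset_leq_card imS).
have c2 : #|X :\: S| <= #|D1|.
  apply: leq_trans (leq_card_succs (subsetDl X S) _) (subset_leq_card imS').
  rewrite setD_eq0; apply: contra SneX => XS.
  by rewrite eqEsubset SX XS.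
apply/splitsP; exists S, D2; split=> //; split=> //.
  by have := link_src L; have := link_dst L; lia.
move=> x y xX yY; rewrite bE //; case: (x \in S) => //=.
exact: DC.
Qed.

End OneLink.

Lemma splits_rev p X Y b : link p X Y b ->
  splits Y X (fun y x => b x y) -> splits X Y b.
Proof.
move=> L /splitsP[A [C [AY A0 AneY [CX AC bE]]]].
apply/splitsP; exists C, A; split=> //.
- by rewrite -card_gt0 -AC card_gt0.
- apply: contra AneY => /eqP CX'; rewrite eqEcard AY AC CX'.
  by rewrite (link_src L) (link_dst L) leqnn.
by split=> // x y xX yY; rewrite bE // addbC.
Qed.

Section Walks.

Variables (p n : nat) (P : nat -> {set T}) (b : nat -> rel T).
Hypothesis L : forall t, t <= n -> link p (P t) (P t.+1) (b t).

Fixpoint reach (t : nat) (S : {set T}) : {set T} :=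
  if t is t'.+1 then succs (b t') (P t) (reach t' S) else S.

Lemma reach_sub t S : S \subset P 0 -> reach t S \subset P t.
Proof. by case: t => //= t _; apply: succs_sub. Qed.

Lemma leq_card_reach t S : t <= n.+1 -> S \subset P 0 -> S != set0 ->
  #|S| <= #|reach t S|.
Proof.
elim: t => // t IH tn SP S0; have IHt := IH (ltnW tn) SP S0.
apply: (leq_trans IHt); apply: (leq_card_succs (L tn) (reach_sub t SP)).
by rewrite -card_gt0 (leq_trans _ IHt) // card_gt0.
Qed.

Lemma reachD s t S : s + t <= n.+1 -> S \subset P 0 -> S != set0 ->
  #|reach s S| <= #|reach (s + t) S|.
Proof.
move=> + SP S0; elim: t => [|t IH] st; first by rewrite addn0.
rewrite addnS in st *.
apply: leq_trans (IH (ltnW st)) (leq_card_succs (L st) (reach_sub _ SP) _).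
by rewrite -card_gt0 (leq_trans _ (leq_card_reach (ltnW st) SP S0)) // card_gt0.
Qed.

Lemma reach_full s t S : s <= t <= n.+1 -> S \subset P 0 -> S != set0 ->
  reach s S = P s -> reach t S = P t.
Proof.
case/andP=> st tn SP S0 full.
apply/eqP; rewrite eqEcard reach_sub //.
have card_P u : u <= n.+1 -> #|P u| = p.
  by case: u => [_|u un]; [apply: link_src (L _) | apply: link_dst (L un)].
rewrite card_P // -(card_P s) ?(leq_trans st) // -full -(subnKC st).
by rewrite reachD ?subnKC.
Qed.

Definition path_walk (m : nat) (w : nat -> T) : Prop :=
  (forall t, t <= m -> w t \in P t) /\
  (forall t, t < m -> ~~ b t (w t) (w t.+1)).

Lemma reach_walk m S y : S \subset P 0 -> y \in reach m S ->
  exists w, [/\ path_walk m w, w 0 \in S & w m = y].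
Proof.
move=> SP; elim: m y => [|m IH] y /= yR.
  exists (fun=> y); split=> //; split=> // t.
  by rewrite leqn0 => /eqP->; apply: (subsetP SP).
have [yP /exists_inP[x xR nb]] := setIdP yR.
have [w [[wP wb] w0 wm]] := IH _ xR.
exists (fun t => if t <= m then w t else y); split; rewrite ?ltnn //.
split=> t; rewrite leq_eqVlt => /orP[/eqP tm|].
- by rewrite tm ltnn.
- by rewrite ltnS => tm; rewrite tm; apply: wP.
- by case: tm => ->; rewrite leqnn ltnn wm.
by rewrite ltnS => tm; rewrite tm (ltnW tm) wb.
Qed.

Definition closed_walk (w : nat -> T) : Prop :=
  path_walk n.+1 w /\ w n.+1 = w 0.

Lemma reach_closed_walk x : x \in P 0 -> x \in reach n.+1 [set x] ->
  exists2 w, closed_walk w & w 0 = x.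
Proof.
move=> xP xR.
have [|w [wP /set1P w0 wn]] := reach_walk (S := [set x]) _ xR.
  by rewrite sub1set.
by exists w => //; split=> //; rewrite wn w0.
Qed.

Hypothesis n_gt0 : 0 < n.
Hypothesis P_cyc : P n.+1 = P 0.

(** Starting points with different successor sets cover the second layer, hence
    all later ones, because every element has a predecessor. *)
Lemma reach_cover x y t : 0 < t <= n.+1 -> x \in P 0 -> y \in P 0 ->
  succs (b 0) (P 1) [set x] != succs (b 0) (P 1) [set y] ->
  reach t [set x] :|: reach t [set y] = P t.
Proof.
case: t => // t /andP[_ tn] xP yP neq; rewrite ltnS in tn.
elim: t tn => [|t IH] tn /=.
  by have [/eqP|] := succs1_cover (L (leq0n n)) xP yP; rewrite ?(negPf neq).
rewrite -succsU IH ?(ltnW tn) //; apply: succs_full (L _) _ => //.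
rewrite -card_gt0 (link_src (L tn)) -(link_src (L (leq0n n))) card_gt0.
by apply/set0Pn; exists x.
Qed.

Lemma reach_same x y t :
  succs (b 0) (P 1) [set x] = succs (b 0) (P 1) [set y] ->
  reach t.+1 [set x] = reach t.+1 [set y].
Proof. by move=> eq; elim: t => //= t ->. Qed.

(** Suppose that no element of [U] reaches itself.  Elements of [U] with the same
    successors in the first step reach the same set in the end, which is at least
    as large as [U] but disjoint from it if this holds for all of [U]; that
    contradicts [p < 2 * #|U|].  So two elements have different successor sets, and
    the sets that they reach in the layer before the last are disjoint and cover it:
    the components of the last link that they occupy form the near-split. *)
Lemma closed_walk_or_near_split U : U \subset P 0 -> p < 2 * #|U| ->
  (exists2 w, closed_walk w & w 0 \in U) \/
  near_split (P n) (P n.+1) U (b n).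
Proof.
move=> UP pU.
have [/exists_inP[u uU uR]|nex] := boolP [exists u in U, u \in reach n.+1 [set u]].
  have [w cw w0] := reach_closed_walk (subsetP UP _ uU) uR.
  by left; exists w; rewrite ?w0.
have stuck u : u \in U -> u \notin reach n.+1 [set u].
  by move=> uU; apply: contra nex => uR; apply/exists_inP; exists u.
right.
have U0 : U != set0 by rewrite -card_gt0; lia.
have [u0 u0U] := set0Pn _ U0.
pose im x := succs (b 0) (P 1) [set x].
have P1 x : x \in U -> x \in P 0 by apply: subsetP.
have sub1 x : x \in U -> [set x] \subset P 0 by rewrite sub1set; apply: P1.
have n01 (x : T) : [set x] != set0 by apply/set0Pn; exists x; rewrite set11.
have nonfull t x : x \in U -> t <= n.+1 -> reach t [set x] != P t.
  move=> xU tn; apply: contra (stuck _ xU) => /eqP full.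
  by rewrite (@reach_full t n.+1) ?tn ?leqnn ?sub1 // P_cyc P1.
have [/forall_inP same|] := boolP [forall u in U, im u == im u0].
  have imU : reach 1 U = im u0.
    apply/setP => y; apply/setIdP/idP => [[yP /exists_inP[u uU nb]]|].
      rewrite -(eqP (same _ uU)) inE yP /=.
      by apply/exists_inP; exists u; rewrite ?set11.
    case/setIdP=> yP /exists_inP[u /set1P-> nb]; split=> //.
    by apply/exists_inP; exists u0.
  have c1 : #|U| <= #|reach n.+1 [set u0]|.
    have := @leq_card_reach 1 U isT UP U0; rewrite imU => /leq_trans; apply.
    by apply: (@reachD 1 n); rewrite ?sub1.
  have : U \subset P 0 :\: reach n.+1 [set u0].
    apply/subsetP => u uU; rewrite inE P1 // andbT.
    by rewrite -(reach_same n (eqP (same _ uU))) stuck.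
  move/subset_leq_card.
  have := cardsID (reach n.+1 [set u0]) (P 0).
  rewrite (setIidPr _) -?P_cyc ?reach_sub ?sub1 // P_cyc (link_src (L (leq0n n))).
  lia.
rewrite negb_forall_in => /exists_inP[u1 u1U neq].
have cover x y t : x \in U -> y \in U -> im x != im y -> 0 < t <= n.+1 ->
    reach t [set x] :|: reach t [set y] = P t.
  by move=> xU yU xy tn; apply: reach_cover; rewrite ?P1.
have nonemp x t : x \in U -> t <= n.+1 -> reach t [set x] != set0.
  move=> xU tn; rewrite -card_gt0.
  by have := leq_card_reach tn (sub1 _ xU) (n01 x); rewrite cards1.
pose S1 := reach n [set u0]; pose S2 := reach n [set u1].
have S12 : S1 :|: S2 = P n by rewrite setUC cover ?n_gt0 ?leqnSn.
have nf1 : succs (b n) (P n.+1) S1 != P n.+1 := nonfull n.+1 u0 u0U (leqnn _).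
have nf2 : succs (b n) (P n.+1) S2 != P n.+1 := nonfull n.+1 u1 u1U (leqnn _).
have dS := cover_disjoint (L (leqnn n)) S12 nf1 nf2.
have ne1 : S1 != set0 by apply: nonemp.
have ne2 : S2 != set0 by apply: nonemp.
pose D1 := P n.+1 :\: reach n.+1 [set u0].
pose D2 := P n.+1 :\: reach n.+1 [set u1].
exists S1, D1, D2; split; first split.
- exact/reach_sub/sub1.
- exact: ne1.
- apply: contra ne2 => /eqP S1P; apply/set0Pn => -[x x2].
  have xP : x \in P n by rewrite -S12 inE x2 orbT.
  by have := disjointFl dS x2; rewrite S1P xP.
- split; rewrite ?subsetDl //.
  + by rewrite setD_eq0; apply: contra nf1 => sub; rewrite eqEsubset succs_sub.
  + by rewrite setD_eq0; apply: contra nf2 => sub; rewrite eqEsubset succs_sub.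
  rewrite -setI_eq0; apply/eqP/setP => y; rewrite in_setI !in_setD in_set0.
  case: (boolP (y \in P n.+1)) => yP; rewrite ?andbF //= !andbT.
  have := cover _ _ n.+1 u1U u0U neq; rewrite ltnS leqnn => /(_ isT)/setP/(_ y).
  by rewrite in_setU yP => /orP[]->; rewrite ?andbF.
- apply/subsetP => z zU.
  rewrite in_setU !in_setD -andb_orl -negb_and P_cyc P1 // andbT.
  (* If [z] is reached from both [u0] and [u1], then its successor set differs from
     theirs, so that it reaches whatever they fail to reach. *)
  apply/negP => /andP[z0 z1].
  have d0 : im z != im u0.
    by apply: contraL z0 => /eqP e; rewrite -(reach_same n e) stuck.
  have d1 : im z != im u1.
    by apply: contraL z1 => /eqP e; rewrite -(reach_same n e) stuck.
  have /negP[] := nonfull n.+1 z zU (leqnn _).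
  suff /eqP full : reach n [set z] == P n.
    by apply/eqP; apply: reach_full full; rewrite ?leqnSn ?leqnn ?sub1.
  rewrite eqEsubset reach_sub ?sub1 //=; apply/subsetP => y yP.
  have tn : 0 < n <= n.+1 by rewrite n_gt0 leqnSn.
  have := cover _ _ n zU u0U d0 tn; have := cover _ _ n zU u1U d1 tn.
  move=> /setP/(_ y) + /setP/(_ y); rewrite !in_setU yP.
  move=> /orP[//|y1] /orP[//|y0]; by have := disjointFl dS y1; rewrite y0.
move=> x y xP yP; case: ifP => xS.
  by rewrite (cover_succs_b (L (leqnn n)) S12 nf1 xS yP) /= in_setD yP andbT.
have xS2 : x \in S2 by have := xP; rewrite -S12 inE xS.
rewrite setUC in S12.
by rewrite (cover_succs_b (L (leqnn n)) S12 nf2 xS2 yP) /= in_setD yP andbT.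
Qed.

(** If all elements of the first layer had a single successor, each would lie in
    a component with [p - 1] elements on the other side; as there is room for only
    one such component when [2 < p], nothing else could be a successor. *)
Lemma reach_two : 2 < p -> exists2 y, y \in P 0 & 1 < #|reach n [set y]|.
Proof.
move=> p3; have L0 := L (leq0n n).
have [/exists_inP[y yP big]|] := boolP [exists y in P 0, 1 < #|reach 1 [set y]|].
  exists y => //; apply: leq_trans big _.
  rewrite -(subnKC n_gt0) reachD ?subnKC ?sub1set //.
  by rewrite -card_gt0 cards1.
move=> nex; have small y : y \in P 0 -> #|succs (b 0) (P 1) [set y]| = 1.
  move=> yP; apply/eqP; rewrite eqn_leq; apply/andP; split.
    by rewrite leqNgt; apply: contra nex => big; apply/exists_inP; exists y.
  have := @leq_card_succs _ _ _ _ L0 [set y]; rewrite sub1set cards1; apply=> //.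
  by rewrite -card_gt0 cards1.
have [u0 u0P] : exists u, u \in P 0.
  by apply/set0Pn; rewrite -card_gt0 (link_src L0); lia.
have same u : u \in P 0 -> succs (b 0) (P 1) [set u] = succs (b 0) (P 1) [set u0].
  move=> uP; have [//|full] := succs1_cover L0 uP u0P.
  have := (leq_card_setU (succs (b 0) (P 1) [set u])
                         (succs (b 0) (P 1) [set u0])).1.
  by rewrite full (link_dst L0) !small //; lia.
have := succs_full L0 _; rewrite -card_gt0 (link_src L0) => /(_ (ltnW (ltnW p3))).
move=> full; suff : P 1 \subset succs (b 0) (P 1) [set u0].
  by move/subset_leq_card; rewrite small // (link_dst L0); lia.
rewrite -{1}full; apply/subsetP => y /setIdP[yP /exists_inP[u uP nb]].
rewrite -(same _ uP) inE yP; apply/exists_inP; exists u; rewrite ?set11 //.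
Qed.

End Walks.

(** The conditions on a link are symmetric, so walks can be run backwards,
    starting from the source of the last link. *)
Lemma closed_walk_or_near_split_rev p n (P : nat -> {set T}) (b : nat -> rel T) U :
  (forall t, t <= n -> link p (P t) (P t.+1) (b t)) ->
  0 < n -> P n.+1 = P 0 -> U \subset P n -> p < 2 * #|U| ->
  (exists2 w, closed_walk n P b w & w n \in U) \/
  near_split (P n.+1) (P n) U (fun y x => b n x y).
Proof.
move=> L n0 cyc UP pU.
pose P' t := if t <= n then P (n - t) else P n.
pose b' t : rel T := fun y x => b (if t < n then n.-1 - t else n) x y.
have L' t : t <= n -> link p (P' t) (P' t.+1) (b' t).
  rewrite /P' /b' => tn; rewrite tn; case: ltnP => nt.
    have e : n - t = (n.-1 - t).+1 by lia.
    rewrite e (_ : n - t.+1 = n.-1 - t); last lia.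
    by apply: link_rev (L _ _); lia.
  have -> : t = n by apply/eqP; rewrite eqn_leq tn.
  by rewrite subnn -cyc; apply: link_rev (L _ _).
have P'0 : P' 0 = P n by rewrite /P' subn0.
have P'n : P' n = P n.+1 by rewrite /P' leqnn subnn cyc.
have P'n1 : P' n.+1 = P n by rewrite /P' ltnn.
have b'n : b' n = (fun y x => b n x y) by rewrite /b' ltnn.
have := @closed_walk_or_near_split p n P' b' L' n0 _ U.
rewrite P'n P'n1 P'0 b'n => /(_ erefl UP pU) [[w [[wP wb] wn] w0]|]; last by right.
left; exists (fun t => if t <= n then w (n - t) else w n); last first.
  by rewrite leqnn subnn.
split; last by rewrite ltnn subn0.
split=> t.
  rewrite leq_eqVlt => /orP[/eqP->|]; rewrite ?ltnS ?ltnn.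
    by rewrite -P'n; apply: wP.
  move=> tn; rewrite tn.
  have := wP (n - t) (leq_trans (leq_subr _ _) (leqnSn _)).
  by rewrite /P' leq_subr subKn.
rewrite ltnS => tn; rewrite tn; case: ltnP => nt.
  have := wb (n.-1 - t); rewrite /b' (_ : (n.-1 - t < n) = true); last lia.
  rewrite (_ : n.-1 - (n.-1 - t) = t); last lia.
  rewrite (_ : (n.-1 - t).+1 = n - t); last lia.
  by rewrite (_ : n.-1 - t = n - t.+1); [apply; lia|lia].
have -> : t = n by apply/eqP; rewrite eqn_leq tn.
by have := wb n (leqnn _); rewrite subnn b'n wn.
Qed.

End Links.

(** * Windows of concatenated orders *)

Section Blocks.

Variables (T : finType) (I : eqType).
Implicit Types (c u : I -> seq T) (ls : seq I) (S : I -> {set T}).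

Lemma uniq_flatten_blocks c ls : uniq ls -> (forall l, l \in ls -> uniq (c l)) ->
  (forall l l' x, l \in ls -> l' \in ls -> x \in c l -> x \in c l' -> l = l') ->
  uniq (flatten [seq c l | l <- ls]).
Proof.
elim: ls => //= a ls IH /andP[als uls] uc dc.
rewrite cat_uniq uc ?mem_head //= IH // => [|l lls|l l' x lls l'ls]; last first.
- by apply: dc; rewrite inE ?lls ?l'ls orbT.
- by apply: uc; rewrite inE lls orbT.
rewrite andbT; apply/hasPn => x /flatten_mapP[l lls xl].
apply: contra als => xa; rewrite (dc a l x) ?mem_head //.
by rewrite inE lls orbT.
Qed.

Lemma filter_flatten_blocks S c ls l : uniq ls ->
  (forall l, l \in ls -> {subset c l <= S l}) ->
  (forall l l' x, x \in S l -> x \in S l' -> l = l') ->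
  [seq x <- flatten [seq c l | l <- ls] | x \in S l] = if l \in ls then c l else [::].
Proof.
move=> + + dS; elim: ls => //= a ls IH /andP[als uls] cS.
rewrite filter_cat IH // => [|l' l'ls]; last by apply: cS; rewrite inE l'ls orbT.
have ca x : x \in c a -> x \in S a by apply: cS; rewrite mem_head.
rewrite inE; have [->|la] /= := eqVneq l a.
  rewrite (negPf als) cats0; apply/all_filterP/allP => x; exact: ca.
rewrite (_ : [seq x <- c a | _] = [::]) //.
rewrite (eq_in_filter (a2 := pred0)) ?filter_pred0 // => x xa /=.
by apply/negP => xl; move: la; rewrite (dS _ _ x xl (ca _ xa)) eqxx.
Qed.

(** Corresponding blocks have the same length, so a cut of the concatenation is a
    cut of one block and leaves every other block on one side; hence the same cut
    [i] serves for both concatenations. *)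
Lemma filter_window_blocks S c c' ls : uniq ls ->
  (forall l, l \in ls -> size (c l) = size (c' l)) ->
  (forall l, l \in ls -> {subset c l <= S l}) ->
  (forall l, l \in ls -> {subset c' l <= S l}) ->
  (forall l l' x, x \in S l -> x \in S l' -> l = l') ->
  forall j l, l \in ls -> exists i,
    [seq x <- drop j (flatten [seq c l | l <- ls]) ++
              take j (flatten [seq c' l | l <- ls]) | x \in S l] =
    drop i (c l) ++ take i (c' l).
Proof.
move=> + + + + dS; elim: ls => //= a ls IH /andP[als uls] sz cS c'S j l lals.
have [ca c'a] : {subset c a <= S a} /\ {subset c' a <= S a}.
  by split; [apply: cS|apply: c'S]; rewrite mem_head.
have tl (P : I -> Prop) : (forall l, l \in a :: ls -> P l) -> forall l, l \in ls -> P l.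
  by move=> Pl l' l'ls; apply: Pl; rewrite inE l'ls orbT.
have fa (s : seq T) : {subset s <= S a} ->
    [seq x <- s | x \in S l] = if l == a then s else [::].
  move=> sa; have [->|la] := eqVneq l a.
    by apply/all_filterP/allP => x; apply: sa.
  rewrite (eq_in_filter (a2 := pred0)) ?filter_pred0 // => x xa /=.
  by apply/negP => xl; move: la; rewrite (dS _ _ x xl (sa _ xa)) eqxx.
have sza : size (c' a) = size (c a) by rewrite -sz ?mem_head.
rewrite drop_cat take_cat sza; case: ltnP => ja.
  rewrite -catA !filter_cat (filter_flatten_blocks _ uls (tl _ cS) dS).
  rewrite !fa; last 2 first.
  - by move=> x /mem_take/c'a.
  - by move=> x /mem_drop/ca.
  have [->|la] := eqVneq l a.
    by exists j; rewrite (negPf als).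
  exists 0; rewrite drop0 take0 cats0 /=.
  by move: lals; rewrite inE (negPf la) /= => ->; rewrite cats0.
rewrite !filter_cat [X in _ ++ X ++ _]fa //.
have [la|la] := eqVneq l a.
  exists (size (c a)); rewrite la drop_size -sza take_size.
  have none (d : I -> seq T) s : (forall l, l \in ls -> {subset d l <= S l}) ->
     {subset s <= flatten [seq d l | l <- ls]} -> [seq x <- s | x \in S a] = [::].
    move=> dls ss; rewrite (eq_in_filter (a2 := pred0)) ?filter_pred0 // => x /ss.
    case/flatten_mapP=> l' l'ls /(dls _ l'ls) xl' /=; apply/negP => xa.
    by rewrite (dS _ _ x xa xl') l'ls in als.
  rewrite (none c) ?(none c') ?cats0 //=; try exact: tl; move=> x.
    exact: mem_take.
  exact: mem_drop.
have lls : l \in ls by move: lals; rewrite inE (negPf la).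
have [i iE] := IH uls (tl _ sz) (tl _ cS) (tl _ c'S) (j - size (c a)) l lls.
by exists i; rewrite -iE filter_cat.
Qed.

End Blocks.

Lemma card_window (T : finType) (s : seq T) (K : {set T}) : uniq s ->
  #|[set x in s] :&: K| = size [seq x <- s | x \in K].
Proof.
move=> us; rewrite -(card_uniqP (filter_uniq _ us)); apply: eq_card => x.
by rewrite !inE mem_filter andbC.
Qed.

Lemma uniq_window (T : finType) (s s' : seq T) j : uniq s -> uniq s' ->
  s = s' \/ [disjoint s & s'] -> uniq (drop j s ++ take j s').
Proof.
move=> us us' [<-|d]; first by rewrite uniq_catC cat_take_drop.
rewrite cat_uniq drop_uniq // take_uniq // andbT /=.
apply/hasPn => x /mem_take xs'; apply/negP => /mem_drop xs.
by have := disjointFr d xs; rewrite xs'.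
Qed.

Lemma size_window (T : finType) (s s' : seq T) j : size s = size s' ->
  size (drop j s ++ take j s') = size s.
Proof.
by move=> e; rewrite size_cat size_drop size_take_min -e /minn; case: ltnP; lia.
Qed.

(** The hypothesis [u k = u 0] closes the cycle of blocks; for [k = 1] the block
    is followed by itself. *)
Lemma take_rot_blocks (T : eqType) (u : nat -> seq T) k r t j :
  (forall t, t < k -> size (u t) = r) -> u k = u 0 -> t < k -> j <= r ->
  take r (rot (t * r + j) (flatten [seq u t | t <- iota 0 k])) =
  drop j (u t) ++ take j (u t.+1).
Proof.
move=> szu cyc tk jr.
have -> : iota 0 k = iota 0 t ++ t :: iota t.+1 (k - t.+1).
  by rewrite -{1}(subnKC (ltnW tk)) iotaD; congr (_ ++ _); rewrite -subSS subSn.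
set A := iota 0 t; rewrite map_cat flatten_cat /=.
have szA : size (flatten [seq u t | t <- A]) = t * r.
  rewrite size_flatten; have -> : shape [seq u t | t <- A] = [seq r | _ <- A].
    rewrite /shape -map_comp; apply/eq_in_map => x.
    by rewrite mem_iota => /andP[_ xt] /=; apply: szu; apply: ltn_trans tk.
  by rewrite sumnE big_map big_const_seq count_predT size_iota iter_addn_0 mulnC.
rewrite addnC rotD; last first.
  by rewrite !size_cat szA szu // addnC leq_add2l; apply: leq_trans jr (leq_addr _ _).
rewrite -szA rot_size_cat /rot -catA.
set F := flatten (map _ (iota t.+1 _)) ++ flatten (map _ A).
rewrite drop_cat [take j (_ ++ _)]take_cat szu //.
have dropE : (if j < r then drop j (u t) ++ F else drop (j - r) F) = drop j (u t) ++ F.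
  case: ltnP => // rj; have -> : j = r by apply/eqP; rewrite eqn_leq jr.
  by rewrite subnn drop0 drop_oversize // szu.
have takeE : (if j < r then take j (u t) else u t ++ take (j - r) F) = take j (u t).
  case: ltnP => // rj; have -> : j = r by apply/eqP; rewrite eqn_leq jr.
  by rewrite subnn take0 cats0 take_oversize // szu.
rewrite dropE takeE -catA take_cat size_drop szu // ltnNge leq_subr /= subKn //.
congr (_ ++ _).
have szu' : size (u t.+1) = r.
  have [t1k|] := ltnP t.+1 k; first exact: szu.
  move=> kt; have -> : t.+1 = k by apply/eqP; rewrite eqn_leq tk.
  by rewrite cyc szu //; apply: leq_trans tk.
have [t1k|kt] := ltnP t.+1 k.
  rewrite /F (_ : k - t.+1 = (k - t.+2).+1); last by rewrite -subSn.
  by rewrite /= -!catA takel_cat // szu'.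
have tE : t.+1 = k by apply/eqP; rewrite eqn_leq tk.
rewrite /F tE subnn /= cyc /A.
case: (t) tE => [|t'] tE /=; first by rewrite take_takel.
by rewrite -catA takel_cat // szu // -tE.
Qed.

(** * Exchanges in elementary split matroids *)

Lemma card_exchange (T : finType) (W K : {set T}) x y : x \in W -> y \notin W ->
  #|(y |: (W :\ x)) :&: K| + (x \in K) = #|W :&: K| + (y \in K).
Proof.
move=> xW yW; have neq : y != x by apply: contraNneq yW => ->.
rewrite setIUl addnC; have -> : [set y] :&: K = if y \in K then [set y] else set0.
  apply/setP => z; rewrite !inE; case: ifP => yK; rewrite !inE; last first.
    by apply/negP => /andP[/eqP->]; rewrite yK.
  by case: eqP => //= ->.
have -> : (W :\ x) :&: K = (W :&: K) :\ x by rewrite setIDAC.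
have := cardsD1 x (W :&: K); rewrite inE xW /=.
have yn : y \notin (W :&: K) :\ x by rewrite !inE (negPf yW) !andbF.
by case: (y \in K); rewrite ?set0U ?(cardsU1 y) ?yn; lia.
Qed.

Lemma card_disjointUI (T : finType) (A Q K : {set T}) : [disjoint A & Q] ->
  #|(A :|: Q) :&: K| = #|A :&: K| + #|Q :&: K|.
Proof.
move=> dAQ; rewrite setIUl -cardsUI.
suff -> : A :&: K :&: (Q :&: K) = set0 by rewrite cards0 addn0.
apply/setP => z; rewrite !inE; case: (boolP (z \in A)) => // zA.
by rewrite (disjointFr dAQ zA) andbF.
Qed.

Lemma card_D1I (T : finType) (A K : {set T}) x : x \in A ->
  #|A :&: K| = (x \in K) + #|(A :\ x) :&: K|.
Proof. by move=> xA; rewrite (cardsD1 x (A :&: K)) inE xA setIDAC. Qed.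

Section SplitFamily.

Variables (T : finType) (q r : nat) (H : 'I_q -> {set T}) (h : 'I_q -> nat).
Hypothesis pair_le : forall i j, i != j -> #|H i :&: H j| + r <= h i + h j.

Implicit Types (X W P Q : {set T}).

(** The bases of the elementary split matroid given by [r], [H] and [h], apart
    from the condition of lying in the ground set. *)
Definition fits (X : {set T}) : bool :=
  (#|X| == r) && [forall i, #|X :&: H i| <= h i].
Definition tight (X : {set T}) (i : 'I_q) : bool := #|X :&: H i| == h i.
Definition bad (W : {set T}) (x y : T) : bool := ~~ fits (y |: (W :\ x)).

Lemma fits_card X : fits X -> #|X| = r.
Proof. by case/andP=> /eqP. Qed.

Lemma fits_le X i : fits X -> #|X :&: H i| <= h i.
Proof. by case/andP=> _ /forallP. Qed.

(** Inclusion-exclusion turns the bound on [H i :&: H j] into a bound on the total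
    distance of [H i] and [H j] from being tight on [X]: each point of [X] that both
    miss, and each common point outside [X], adds one to it. *)
Lemma pair_slack X i j : #|X| = r -> i != j ->
  #|X :&: H i| + #|X :&: H j| + #|X :\: (H i :|: H j)|
    + #|(H i :&: H j) :\: X| <= h i + h j.
Proof.
move=> Xr ij; apply: leq_trans (pair_le ij).
have := cardsUI (X :&: H i) (X :&: H j); rewrite -setIUr -setIIr.
have := cardsID (H i :|: H j) X; have := cardsID X (H i :&: H j).
by rewrite [H i :&: H j :&: X]setIC; lia.
Qed.

Lemma tight_cover X i j x : fits X -> i != j -> tight X i -> tight X j ->
  x \in X -> (x \in H i) || (x \in H j).
Proof.
move=> fX ij /eqP ti /eqP tj xX; have := pair_slack (fits_card fX) ij.
rewrite ti tj; set n := #|X :\: _| => ?.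
have /eqP : n = 0 by lia.
rewrite cards_eq0 => /eqP/setP/(_ x); rewrite !inE xX andbT.
by move=> /negbFE.
Qed.

Lemma tight_capS X i j x : fits X -> i != j -> tight X i -> tight X j ->
  x \in H i -> x \in H j -> x \in X.
Proof.
move=> fX ij /eqP ti /eqP tj xi xj; have := pair_slack (fits_card fX) ij.
rewrite ti tj; set n := #|(_ :&: _) :\: _| => ?.
have /eqP : n = 0 by lia.
rewrite cards_eq0 => /eqP/setP/(_ x); rewrite !inE xi xj.
by case: (x \in X).
Qed.

Lemma missed_unique X i j x : fits X -> tight X i -> tight X j ->
  x \in X -> x \notin H i -> x \notin H j -> i = j.
Proof.
move=> fX ti tj xX /negPf xi /negPf xj; apply/eqP; apply: contraT => ij.
by have := tight_cover fX ij ti tj xX; rewrite xi xj.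
Qed.

Lemma hit_unique X i j x : fits X -> tight X i -> tight X j ->
  x \notin X -> x \in H i -> x \in H j -> i = j.
Proof.
move=> fX ti tj xX xi xj; apply/eqP; apply: contraT => ij.
by rewrite (tight_capS fX ij ti tj xi xj) in xX.
Qed.

Lemma badP W x y : fits W -> x \in W -> y \notin W ->
  reflect (exists i, [/\ tight W i, x \notin H i & y \in H i]) (bad W x y).
Proof.
move=> fW xW yW.
have cardX : #|y |: (W :\ x)| = r.
  have := card_exchange setT xW yW; rewrite !setIT !inE.
  by have := fits_card fW; lia.
rewrite /bad /fits cardX eqxx /= negb_forall.
apply: (iffP existsP) => [[i]|[i [/eqP ti /negPf xi yi]]]; last first.
  by exists i; have := card_exchange (H i) xW yW; rewrite ti xi yi; lia.
have := card_exchange (H i) xW yW; have := fits_le i fW.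
rewrite -ltnNge => le e lt; exists i; rewrite /tight.
move: e; case: (x \in H i); case: (y \in H i) => e; split=> //; lia.
Qed.

(** One link in the course of the exchanges: [P] and [P'] are the remaining parts
    of two consecutive bases and [Q] is the part of the window that is already
    final, so that [P :|: Q] is the current window and [P' :|: Q] is the last one.
    The latter equals the next basis during the whole process. *)
Record stage (p : nat) (P P' Q : {set T}) : Prop := Stage {
  disj_PQ : [disjoint P & Q];
  disj_P'Q : [disjoint P' & Q];
  disj_PP' : [disjoint P & P'];
  card_P : #|P| = p;
  card_P' : #|P'| = p;
  fits_old : fits (P :|: Q);
  fits_new : fits (P' :|: Q)
}.

Section OneStage.
Variables (p : nat) (P P' Q : {set T}).
Hypothesis st : stage p P P' Q.
Local Notation W := (P :|: Q).
Local Notation V := (P' :|: Q).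
Local Notation fW := (fits_old st).
Local Notation fV := (fits_new st).

Lemma P_W x : x \in P -> x \in W. Proof. by rewrite inE => ->. Qed.
Lemma P'_V x : x \in P' -> x \in V. Proof. by rewrite inE => ->. Qed.
Lemma P'_notW y : y \in P' -> y \notin W.
Proof.
by move=> yP; rewrite inE (disjointFl (disj_PP' st) yP) (disjointFr (disj_P'Q st) yP).
Qed.
Lemma P_notV x : x \in P -> x \notin V.
Proof.
by move=> xP; rewrite inE (disjointFr (disj_PP' st) xP) (disjointFr (disj_PQ st) xP).
Qed.

Lemma card_W i : #|W :&: H i| = #|P :&: H i| + #|Q :&: H i|.
Proof. exact: card_disjointUI (disj_PQ st). Qed.

Lemma card_V i : #|V :&: H i| = #|P' :&: H i| + #|Q :&: H i|.
Proof. exact: card_disjointUI (disj_P'Q st). Qed.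

Lemma tight_le i : tight W i -> #|P' :&: H i| <= #|P :&: H i|.
Proof. by move=> /eqP; have := fits_le i fV; rewrite card_V card_W; lia. Qed.

Lemma tight_new i : tight W i -> tight V i = (#|P :&: H i| == #|P' :&: H i|).
Proof.
move=> /eqP; rewrite /tight card_V card_W => <-; rewrite eqn_add2r.
exact: eq_sym.
Qed.

(** The tight set that makes [(x, y)] bad is the only tight set missing [x] and the
    only one containing [y], so it accounts for the whole component of [(x, y)]. *)
Lemma bad_block x y : x \in P -> y \in P' -> bad W x y ->
  exists i, [/\ tight W i, {in P, forall x', (x' \notin H i) = bad W x' y} &
                {in P', forall y', (y' \in H i) = bad W x y'}].
Proof.
move=> xP yP' /(badP fW (P_W xP) (P'_notW yP'))[i [ti xi yi]].
exists i; split=> // [x' x'P|y' y'P].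
  apply/idP/(badP fW (P_W x'P) (P'_notW yP')) => [x'i|[j [tj x'j yj]]].
    by exists i.
  by rewrite (hit_unique fW ti tj (P'_notW yP')).
apply/idP/(badP fW (P_W xP) (P'_notW y'P)) => [y'i|[j [tj xj y'j]]].
  by exists i.
by rewrite (missed_unique fW ti tj (P_W xP)).
Qed.

Lemma stage_link : link p P P' (bad W).
Proof.
split; [exact: card_P st|exact: card_P' st| |].
  move=> x x' y y' xP x'P yP y'P bxy bxy' bx'y.
  have [i [ti row col]] := bad_block xP yP bxy.
  apply/(badP fW (P_W x'P) (P'_notW y'P)); exists i.
  by rewrite row // col.
move=> x y xP yP bxy; have [i [ti row col]] := bad_block xP yP bxy.
have -> : [set x' in P | bad W x' y] = P :\: H i.
  apply/setP=> z; rewrite !inE; case: (boolP (z \in P)) => zP; rewrite ?andbF //.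
  by rewrite row ?andbT.
have -> : [set y' in P' | bad W x y'] = P' :&: H i.
  by apply/setP=> z; rewrite !inE; case: (boolP (z \in P')) => // zP; rewrite col.
have := cardsID (H i) P; have := tight_le ti; have := card_P st; lia.
Qed.

(** A split link means that, after contracting [Q], the matroid on [P :|: P'] is a
    direct sum of two uniform matroids of positive rank, with the traces of [H i]
    and [H j] as ground sets. *)
Lemma splits_tightP :
  reflect (exists i j, [/\ i != j, tight W i && tight W j, tight V i && tight V j,
             exists2 y, y \in P' & y \notin H i &
             exists2 y, y \in P' & y \notin H j])
    (splits P P' (bad W)).
Proof.
apply: (iffP (splitsP _ _ _)); last first.
  case=> i [j [ij /andP[ti tj] /andP[vi vj] [yi yiP yiH] [yj yjP yjH]]].
  have Pij x : x \in P -> (x \in H i) = (x \notin H j).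
    move=> xP; have := tight_cover fW ij ti tj (P_W xP).
    case: (boolP (x \in H j)) => [xj _|_]; last by rewrite orbF.
    apply/negP => xi; have := tight_capS fV ij vi vj xi xj.
    by rewrite (negPf (P_notV xP)).
  have P'ij x : x \in P' -> (x \in H i) = (x \notin H j).
    move=> xP; have := tight_cover fV ij vi vj (P'_V xP).
    case: (boolP (x \in H j)) => [xj _|_]; last by rewrite orbF.
    apply/negP => xi; have := tight_capS fW ij ti tj xi xj.
    by rewrite (negPf (P'_notW xP)).
  have := vi; have := vj; rewrite !tight_new // => /eqP cj /eqP ci.
  have jyi : yi \in H j by apply: contraR yiH => yij; rewrite P'ij.
  have iyj : yj \in H i by rewrite P'ij.
  exists (P :&: H j), (P' :&: H j); split; first exact: subsetIl.
  - rewrite -card_gt0 cj card_gt0; apply/set0Pn; exists yi.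
    by rewrite inE yiP.
  - have [x] : exists x, x \in P :&: H i.
      apply/set0Pn; rewrite -card_gt0 ci card_gt0; apply/set0Pn.
      by exists yj; rewrite inE yjP.
    case/setIP=> xP; rewrite (Pij _ xP); apply: contra => /eqP e.
    by move: xP; rewrite -{1}e => /setIP[].
  split; rewrite ?subsetIl // => x y xP yP; rewrite !inE xP yP /=.
  apply/(badP fW (P_W xP) (P'_notW yP))/idP => [[l [tl xl yl]]|].
    case: (boolP (x \in H j)) xl => xj xl.
      suff : y \notin H j by [].
      rewrite -P'ij //; suff -> : i = l by [].
      by apply: (missed_unique fW ti tl (P_W xP)) => //; rewrite (Pij _ xP) negbK.
    suff : y \in H j by [].
    by rewrite (missed_unique fW tj tl (P_W xP)).
  case: (boolP (x \in H j)) => xj /= yHj; last by exists j.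
  by exists i; rewrite Pij // xj P'ij.
case=> A [C [AP A0 AneP [CP' AC bE]]].
have [a aA] := set0Pn _ A0.
have [a' a'P a'A] : exists2 x, x \in P & x \notin A.
  by apply/subsetPn; apply: contra AneP => PA; rewrite eqEsubset AP PA.
have [c cC] : exists c, c \in C by apply/set0Pn; rewrite -card_gt0 -AC card_gt0.
have [c' c'P c'C] : exists2 x, x \in P' & x \notin C.
  apply/subsetPn; apply: contra AneP => /subset_leq_card.
  by rewrite eqEcard AP AC (card_P st) (card_P' st).
have aP := subsetP AP _ aA; have cP := subsetP CP' _ cC.
have [|i [ti rowi coli]] := bad_block aP c'P.
  by rewrite bE // aA (negPf c'C).
have [|j [tj rowj colj]] := bad_block a'P cP.
  by rewrite bE // cC (negPf a'A).
have PHi : P :&: H i = P :\: A.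
  apply/setP=> z; rewrite !inE; case: (boolP (z \in P)) => zP; rewrite ?andbF //=.
  by rewrite -[z \in H i]negbK rowi // bE // (negPf c'C) addbF andbT.
have PHj : P :&: H j = A.
  apply/setP=> z; rewrite !inE; case: (boolP (z \in P)) => zP; last first.
    by apply/esym/negP => /(subsetP AP); apply/negP.
  by rewrite -[z \in H j]negbK rowj // bE // cC addbT negbK.
have P'Hi : P' :&: H i = P' :\: C.
  apply/setP=> z; rewrite !inE; case: (boolP (z \in P')) => zP; rewrite ?andbF //=.
  by rewrite coli // bE // aA andbT.
have P'Hj : P' :&: H j = C.
  apply/setP=> z; rewrite !inE; case: (boolP (z \in P')) => zP; last first.
    by apply/esym/negP => /(subsetP CP'); apply/negP.
  by rewrite colj // bE // (negPf a'A).
exists i, j; rewrite !tight_new // ti tj PHi PHj P'Hi P'Hj AC eqxx.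
have -> : #|P :\: A| = #|P' :\: C|.
  apply/eqP; rewrite -(eqn_add2l #|A|) {2}AC.
  have := cardsID A P; have := cardsID C P'; rewrite (setIidPr AP) (setIidPr CP').
  by rewrite (card_P st) (card_P' st) => -> ->.
rewrite eqxx; split=> //.
- by apply: contraTneq (aA) => ij; rewrite -PHj -ij PHi inE aA.
- by exists c => //; rewrite coli // bE // aA cC.
by exists c' => //; rewrite colj // bE // (negPf a'A) (negPf c'C).
Qed.

End OneStage.

Lemma stage_move p P P' Q x y : stage p.+1 P P' Q -> x \in P -> y \in P' ->
  ~~ bad (P :|: Q) x y -> stage p (P :\ x) (P' :\ y) (y |: Q).
Proof.
move=> st xP yP nb.
have yQ : y \notin Q by rewrite (disjointFr (disj_P'Q st) yP).
have yP0 : y \notin P by rewrite (disjointFl (disj_PP' st) yP).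
have xQ : x \notin Q by rewrite (disjointFr (disj_PQ st) xP).
split.
- rewrite -setI_eq0; apply/eqP/setP => z; rewrite !inE.
  case: (eqVneq z y) => [->|_] /=; first by rewrite (negPf yP0) andbF.
  case: (boolP (z \in P)) => zP; rewrite ?andbF //.
  by rewrite (disjointFr (disj_PQ st) zP) andbF.
- rewrite -setI_eq0; apply/eqP/setP => z; rewrite !inE.
  case: (eqVneq z y) => [->|_] //=.
  by case: (boolP (z \in P')) => // zP; rewrite (disjointFr (disj_P'Q st) zP).
- exact: disjointWl (subD1set _ _) (disjointWr (subD1set _ _) (disj_PP' st)).
- by have := cardsD1 x P; rewrite xP (card_P st); lia.
- by have := cardsD1 y P'; rewrite yP (card_P' st); lia.
- move: nb; rewrite /bad negbK; congr (is_true (fits _)); apply/setP => z.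
  rewrite !inE; case: (eqVneq z x) => [->|]; rewrite ?(negPf xQ) ?orbF //=.
  by case: (z == y); rewrite ?orbT.
- have := fits_new st; congr (is_true (fits _)); apply/setP => z; rewrite !inE.
  by case: (eqVneq z y) => [->|] //=; rewrite yP.
Qed.

Definition conflict P P' Q x y : bool :=
  [&& x \in P, y \in P', ~~ bad (P :|: Q) x y &
      splits (P :\ x) (P' :\ y) (bad (P :\ x :|: (y |: Q)))].

Section Conflicts.

Variables (p : nat) (P P' Q : {set T}).
Hypothesis st : stage p P P' Q.
Hypothesis nosplit : ~~ splits P P' (bad (P :|: Q)).
Local Notation W := (P :|: Q).
Local Notation V := (P' :|: Q).
Local Notation fW := (fits_old st).
Local Notation fV := (fits_new st).

(** By [splits_tightP], a conflict produces sets [H i] and [H j] that split the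
    link once [x] and [y] are gone.  They are tight on the new basis, and they
    partition the other elements of [P] and of [P'].  Only [x] may be left
    uncovered, and only [y] may be covered twice; since the link does not split
    before the exchange, at least one of the two happens ([wit_xP]). *)
Record witness (x y : T) (i j : 'I_q) : Prop := Witness {
  wit_x : x \in P;
  wit_y : y \in P';
  wit_neq : i != j;
  wit_Vi : tight V i;
  wit_Vj : tight V j;
  wit_cardi : #|(P :\ x) :&: H i| = #|(P' :\ y) :&: H i|;
  wit_cardj : #|(P :\ x) :&: H j| = #|(P' :\ y) :&: H j|;
  wit_missi : exists z, [/\ z \in P', z != y & z \notin H i];
  wit_missj : exists z, [/\ z \in P', z != y & z \notin H j];
  wit_P : forall z, z \in P -> z != x -> (z \in H i) = (z \notin H j);
  wit_P' : forall z, z \in P' -> z != y -> (z \in H i) = (z \notin H j);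
  wit_xP : ~~ ((y \in H i) && (y \in H j)) -> x \notin H i /\ x \notin H j
}.

Lemma witness_sym x y i j : witness x y i j -> witness x y j i.
Proof.
case=> xP yP ij vi vj ci cj mi mj wP wP' wxP; split=> //.
- by rewrite eq_sym.
- by move=> z zP zx; rewrite wP // negbK.
- by move=> z zP zx; rewrite wP' // negbK.
by rewrite andbC => /wxP[].
Qed.

(** If [x] lay in [H b], the present window would exceed the bound on [H b]; if it
    lay in [H a], both sets would be tight on that window and split the link. *)
Lemma uncovered x y a b :
  x \in P -> y \in P' -> a != b -> tight V a -> tight V b ->
  #|(P :\ x) :&: H a| = #|(P' :\ y) :&: H a| ->
  #|(P :\ x) :&: H b| = #|(P' :\ y) :&: H b| ->
  (exists2 z, z \in P' & z \notin H a) ->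
  (exists2 z, z \in P' & z \notin H b) ->
  y \in H a -> y \notin H b -> x \notin H a /\ x \notin H b.
Proof.
move=> xP yP ab va vb ca cb ma mb ya yb.
have := va; have := vb; rewrite /tight !(card_V st) => /eqP hb /eqP ha.
have := fits_le b fW; rewrite (card_W st).
have := card_D1I (H a) xP; have := card_D1I (H b) xP.
have := card_D1I (H a) yP; have := card_D1I (H b) yP.
rewrite ya (negPf yb) /= => e1 e2 e3 e4 le.
have xb : x \notin H b.
  by apply/negP => xb; rewrite xb in e3; clear -hb cb e1 e3 le; lia.
split=> //; apply: contra nosplit => xa; apply/(splits_tightP st).
exists a, b; rewrite va vb; split=> //; apply/andP; split; apply/eqP.
  by rewrite (card_W st) e4 xa -ha e2 ca.
by rewrite (card_W st) e3 (negPf xb) -hb e1 cb.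
Qed.

Lemma conflict_witness x y : conflict P P' Q x y -> exists i j, witness x y i j.
Proof.
case/and4P=> xP yP ok.
have := st; case: (p) => [[_ _ _ /eqP]|p' st'].
  by rewrite cards_eq0 => /eqP P0; rewrite P0 inE in xP.
have stm := stage_move st' xP yP ok.
have VE : P' :\ y :|: (y |: Q) = V.
  by apply/setP => z; rewrite !inE; case: (eqVneq z y) => [->|] //=; rewrite yP.
case/(splits_tightP stm) => i [j [ij /andP[ti tj] vij mi mj]].
have /andP[vi vj] := vij; move: (vij); rewrite VE => /andP[Vi Vj].
move: mi mj => [zi]; rewrite in_setD1 => /andP[ziy ziP] ziH.
move=> [zj]; rewrite in_setD1 => /andP[zjy zjP] zjH.
have ci : #|(P :\ x) :&: H i| = #|(P' :\ y) :&: H i|.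
  by apply/eqP; rewrite -(tight_new stm).
have cj : #|(P :\ x) :&: H j| = #|(P' :\ y) :&: H j|.
  by apply/eqP; rewrite -(tight_new stm).
exists i, j; split=> //; [by exists zi|by exists zj| | |].
- move=> z zP zx; have zPx : z \in P :\ x by rewrite !inE zx.
  have := tight_cover (fits_old stm) ij ti tj (P_W _ zPx).
  case: (boolP (z \in H j)) => [zHj _|_]; last by rewrite orbF.
  apply/negP => zHi; have := tight_capS fV ij Vi Vj zHi zHj.
  by rewrite (negPf (P_notV st zP)).
- move=> z zP zy; have zPy : z \in P' :\ y by rewrite !inE zy.
  have := tight_cover fV ij Vi Vj (P'_V _ zP).
  case: (boolP (z \in H j)) => [zHj _|_]; last by rewrite orbF.
  apply/negP => zHi; have := tight_capS (fits_old stm) ij ti tj zHi zHj.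
  by rewrite (negPf (P'_notW stm zPy)).
have exi : exists2 z, z \in P' & z \notin H i by exists zi.
have exj : exists2 z, z \in P' & z \notin H j by exists zj.
have := tight_cover fV ij Vi Vj (P'_V _ yP).
case: (boolP (y \in H i)) => yi /=; case: (boolP (y \in H j)) => yj //= _ _.
  exact: (uncovered xP yP ij).
by rewrite eq_sym in ij; have [] := uncovered xP yP ij Vj Vi cj ci exj exi yj yi.
Qed.

(** Distinct tight sets miss disjoint parts of a basis, and [z] is already missed
    by [H i] or [H j]. *)
Lemma missed_pair x y i j m z : witness x y i j -> tight V m -> z \in P' ->
  z \notin H m -> ~~ ((z \in H i) && (z \in H j)) -> m = i \/ m = j.
Proof.
move=> w vm zP zm; rewrite negb_and => /orP[] zn.
  by left; apply: (missed_unique fV vm (wit_Vi w) (P'_V _ zP)).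
by right; apply: (missed_unique fV vm (wit_Vj w) (P'_V _ zP)).
Qed.

Lemma missed_pair_neq x y i j m z : witness x y i j -> tight V m -> z \in P' ->
  z \notin H m -> z != y -> m = i \/ m = j.
Proof.
move=> w vm zP zm zy; apply: (missed_pair w vm zP zm).
by rewrite (wit_P' w zP zy) andNb.
Qed.

(** When [y] is covered once, [H i] and [H j] together miss all of [P'], so every
    conflict has the same pair of sets as witness, and [x] is the element of [P]
    that this pair leaves uncovered. *)
Lemma conflict_row_unique x y i j x2 y2 : witness x y i j ->
  ~~ ((y \in H i) && (y \in H j)) -> conflict P P' Q x2 y2 -> x2 = x.
Proof.
move=> w yij /conflict_witness[i2 [j2 w2]].
have nb z : z \in P' -> ~~ ((z \in H i) && (z \in H j)).
  move=> zP; have [->//|zy] := eqVneq z y.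
  by rewrite (wit_P' w zP zy) andNb.
have [zi [ziP _ zim]] := wit_missi w2; have [zj [zjP _ zjm]] := wit_missj w2.
have mi := missed_pair w (wit_Vi w2) ziP zim (nb _ ziP).
have mj := missed_pair w (wit_Vj w2) zjP zjm (nb _ zjP).
apply/eqP; apply: contraT => xx2; have := wit_P w (wit_x w2) xx2.
have := wit_neq w2; have := wit_xP w2; have := nb _ (wit_y w2).
case: mi => ->; case: mj => ->; rewrite ?eqxx //.
  by move=> ny /(_ ny)[/negPf-> /negPf->].
by rewrite andbC => ny /(_ ny)[/negPf-> /negPf->].
Qed.

(** A component of bad pairs is the trace of a tight set. *)
Lemma near_block (A C : {set T}) : A \subset P -> C \subset P' ->
  A != set0 -> C != set0 ->
  {in P & C, forall x y, bad W x y = (x \in A)} ->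
  {in A & P', forall x y, bad W x y = (y \in C)} ->
  exists m, [/\ tight W m, P :&: H m = P :\: A & P' :&: H m = C].
Proof.
move=> AP CP /set0Pn[a aA] /set0Pn[c cC] bC bA.
have aP := subsetP AP _ aA; have cP := subsetP CP _ cC.
have [|m [tm row col]] := bad_block st aP cP; first by rewrite bC.
exists m; split=> //; apply/setP => z; rewrite !inE.
  case: (boolP (z \in P)) => zP; rewrite ?andbF //= andbT.
  by rewrite -(bC _ _ zP cC) -row // negbK.
case: (boolP (z \in P')) => zP /=; first by rewrite col // bA.
by apply/esym/negP => /(subsetP CP); apply/negP.
Qed.

(** Counting shows that one of the two components of the near-split comes from a set
    that is tight on the new basis as well.  It does not contain [y], so it differs
    from [H i] and [H j] and must contain all of [P'] except [y].  This leaves no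
    room for the other component. *)
Lemma no_near_split_col x y i j : witness x y i j -> y \in H i -> y \in H j ->
  ~ near_split P P' (P' :\ y) (bad W).
Proof.
move=> w yi yj [S [D1 [D2 [[SP S0 SneP] [D1P D2P D10 D20 dD] UD bE]]]].
have [yD|yD] := boolP (y \in D1 :|: D2).
  have /negP[] := nosplit; apply: (near_split_splits (stage_link st)).
  exists S, D1, D2; split=> //.
  by rewrite -(setD1K (wit_y w)) subUset sub1set yD.
have [m1 [t1 P1 P'1]] : exists m,
    [/\ tight W m, P :&: H m = P :\: S & P' :&: H m = D1].
  apply: near_block => // [x' y' x'P y'D|x' y' x'S y'P].
    rewrite bE ?(subsetP D1P) // y'D (disjointFr dD y'D); by case: ifP.
  by rewrite bE ?(subsetP SP) // x'S.
have S'0 : P :\: S != set0.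
  by rewrite setD_eq0; apply: contra SneP => PS; rewrite eqEsubset SP.
have [m2 [t2 P2 P'2]] : exists m,
    [/\ tight W m, P :&: H m = P :\: (P :\: S) & P' :&: H m = D2].
  apply: near_block; rewrite ?subsetDl //.
    move=> x' y' x'P y'D; rewrite bE ?(subsetP D2P) // y'D (disjointFl dD y'D).
    rewrite !inE x'P andbT.
    by case: (x' \in S).
  by move=> x' y' /setDP[x'P /negPf x'S] y'P; rewrite bE // x'S.
have impossible m D D' : tight V m -> P' :&: H m = D -> D' != set0 -> D' \subset P' ->
    [disjoint D & D'] -> y \notin D -> y \notin D' -> False.
  move=> vm P'm /set0Pn[d dD'] D'P dDD yD0 yD'.
  have dP := subsetP D'P _ dD'.
  have dm : d \notin H m.
    have := disjointFl dDD dD'; rewrite -P'm inE dP /= => ->. by [].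
  have dy : d != y by apply: contraNneq yD' => <-.
  have yP := wit_y w.
  case: (missed_pair_neq w vm dP dm dy) => e; move: yD0; rewrite -P'm inE yP e.
    by rewrite yi.
  by rewrite yj.
move: yD; rewrite inE negb_or => /andP[yD1 yD2].
have := tight_le st t1; have := tight_le st t2; rewrite P1 P2 P'1 P'2.
have := cardsID S P; rewrite (setIidPr SP) (card_P st).
rewrite setDDr setDv set0U (setIidPr SP) => cS c2 c1.
have c12 : p <= (#|D1| + #|D2|).+1.
  have := cardsD1 y P'; rewrite (wit_y w) (card_P' st) => ->.
  rewrite add1n ltnS; apply: leq_trans (subset_leq_card UD) _.
  exact: (leq_card_setU D1 D2).1.
have [e1|e2] : #|P :\: S| = #|D1| \/ #|S| = #|D2|.
  by clear -cS c2 c1 c12; lia.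
  apply: (impossible m1 D1 D2) => //.
  by rewrite (tight_new st t1) P1 P'1 e1.
apply: (impossible m2 D2 D1) => //; last by rewrite disjoint_sym.
by rewrite (tight_new st t2) P2 P'2 setDDr setDv set0U (setIidPr SP) e2.
Qed.

(** Again one component comes from a set that is tight on the new basis.  It contains
    [x], so it differs from [H i] and [H j], but these two already miss every
    element of [P'] between them. *)
Lemma no_near_split_row x y i j : witness x y i j ->
  ~~ ((y \in H i) && (y \in H j)) ->
  ~ near_split P' P (P :\ x) (fun y x => bad W x y).
Proof.
move=> w yij [S [D1 [D2 [[SP S0 SneP] [D1P D2P D10 D20 dD] UD bE]]]].
have [xi xj] := wit_xP w yij.
have [xD|xD] := boolP (x \in D1 :|: D2).
  have /negP[] := nosplit; apply: (splits_rev (stage_link st)).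
  apply: (near_split_splits (link_rev (stage_link st))).
  exists S, D1, D2; split=> //.
  by rewrite -(setD1K (wit_x w)) subUset sub1set xD.
have S'0 : P' :\: S != set0.
  by rewrite setD_eq0; apply: contra SneP => PS; rewrite eqEsubset SP.
have [m1 [t1 P1 P'1]] : exists m,
    [/\ tight W m, P :&: H m = P :\: D1 & P' :&: H m = S].
  apply: near_block => // [x' y' x'P y'S|x' y' x'D y'P].
    by rewrite bE ?(subsetP SP) // y'S.
  rewrite bE ?(subsetP D1P) // x'D (disjointFr dD x'D); by case: ifP.
have [m2 [t2 P2 P'2]] : exists m,
    [/\ tight W m, P :&: H m = P :\: D2 & P' :&: H m = P' :\: S].
  apply: near_block; rewrite ?subsetDl //.
    by move=> x' y' x'P /setDP[y'P /negPf y'S]; rewrite bE // y'S.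
  move=> x' y' x'D y'P; rewrite bE ?(subsetP D2P) // x'D (disjointFl dD x'D).
  rewrite !inE y'P andbT.
  by case: (y' \in S).
have impossible m D E : tight V m -> P :&: H m = P :\: D -> x \notin D ->
    E != set0 -> E \subset P' -> (forall e, e \in E -> e \notin H m) -> False.
  move=> vm Pm xnD /set0Pn[e eE] EP Em; have eP := subsetP EP _ eE.
  have xm : x \in H m.
    by have /setP/(_ x) := Pm; rewrite !inE (wit_x w) xnD /=.
  have eij : ~~ ((e \in H i) && (e \in H j)).
    have [->//|ey] := eqVneq e y; by rewrite (wit_P' w eP ey) andNb.
  case: (missed_pair w vm eP (Em _ eE) eij) => em; move: xm; rewrite em.
    by rewrite (negPf xi).
  by rewrite (negPf xj).
move: xD; rewrite inE negb_or => /andP[xD1 xD2].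
have := tight_le st t1; have := tight_le st t2; rewrite P1 P2 P'1 P'2.
have := cardsID S P'; rewrite (setIidPr SP) (card_P' st).
have := cardsID D1 P; rewrite (setIidPr D1P) (card_P st).
have := cardsID D2 P; rewrite (setIidPr D2P) (card_P st) => cD2 cD1 cS c2 c1.
have c12 : p <= (#|D1| + #|D2|).+1.
  have := cardsD1 x P; rewrite (wit_x w) (card_P st) => ->.
  rewrite add1n ltnS; apply: leq_trans (subset_leq_card UD) _.
  exact: (leq_card_setU D1 D2).1.
have [e1|e2] : #|P :\: D1| = #|S| \/ #|P :\: D2| = #|P' :\: S|.
  by clear -cD1 cD2 cS c1 c2 c12; lia.
  apply: (impossible m1 D1 (P' :\: S)) => //; rewrite ?subsetDl //.
    by rewrite (tight_new st t1) P1 P'1 e1.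
  move=> e /setDP[eP eS]; apply: contra eS => em.
  by rewrite -P'1 inE eP.
apply: (impossible m2 D2 S) => //; first by rewrite (tight_new st t2) P2 P'2 e2.
move=> e eS; have eP := subsetP SP _ eS; apply/negP => em.
by have /setP/(_ e) := P'2; rewrite !inE eP em eS.
Qed.

(** By [pair_slack], a set [H m] that is one short of tight and any tight set cannot
    both miss [x] and both contain [y]. *)
Lemma slack_no_bad m x y : #|W :&: H m| < h m -> h m <= #|W :&: H m| + 1 ->
  x \in P -> y \in P' -> x \notin H m -> y \in H m -> ~~ bad W x y.
Proof.
move=> lt le xP yP xm ym; apply/negP => /(badP fW (P_W _ xP) (P'_notW st yP)).
case=> l [tl xl yl].
have ml : m != l by apply: contraTneq tl => <-; rewrite /tight ltn_eqF.
have := pair_slack (fits_card fW) ml; rewrite (eqP tl).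
have : 0 < #|W :\: (H m :|: H l)|.
  by rewrite card_gt0; apply/set0Pn; exists x; rewrite !inE xP (negPf xm) (negPf xl).
have : 0 < #|(H m :&: H l) :\: W|.
  rewrite card_gt0; apply/set0Pn; exists y.
  by rewrite in_setD (P'_notW st yP) inE ym yl.
clear -lt le; lia.
Qed.

Lemma witness_p x y i j : witness x y i j -> 2 < p.
Proof.
move=> w; have [zi [ziP ziy zim]] := wit_missi w.
have [zj [zjP zjy zjm]] := wit_missj w.
have zij : zi != zj.
  apply: contraTneq (wit_neq w) => e; rewrite -e in zjm.
  by rewrite (missed_unique fV (wit_Vi w) (wit_Vj w) (P'_V _ ziP) zim zjm) eqxx.
rewrite -(card_P' st).
have <- : #|[set y; zi; zj]| = 3.
  by rewrite -setUA cardsU1 cards2 !inE negb_or eq_sym ziy eq_sym zjy zij.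
apply: subset_leq_card; apply/subsetP => z; rewrite !inE.
by case/orP=> [/orP[]|] /eqP-> //; apply: wit_y w.
Qed.

(** Two conflicts with the same [y] have the same pair of sets as witness, since both
    pairs miss every element of [P'] other than [y]. *)
Lemma conflict_column_unique x1 x2 y i1 j1 i2 j2 :
  witness x1 y i1 j1 -> witness x2 y i2 j2 ->
  x1 \notin H i1 -> x1 \notin H j1 -> x2 \notin H i2 -> x2 \notin H j2 ->
  x1 = x2.
Proof.
move=> w1 w2 x1i x1j x2i x2j; apply/eqP; apply: contraT => x12.
have [zi [ziP ziy zim]] := wit_missi w1; have [zj [zjP zjy zjm]] := wit_missj w1.
have := wit_P w2 (wit_x w1) x12; have := wit_neq w1.
case: (missed_pair_neq w2 (wit_Vi w1) ziP zim ziy) x1i => ->;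
case: (missed_pair_neq w2 (wit_Vj w1) zjP zjm zjy) x1j => ->;
by rewrite ?eqxx // => /negPf-> /negPf->.
Qed.

(** Two conflicts whose second elements differ and are both covered twice.  The set
    [H i] then misses only [y2] in [P'], the set [H i2] misses only [y], and [H j2] is
    [H j].  The traces on [P] of these three sets are disjoint, of sizes at least [p - 2],
    [p - 2] and 1, which forces [p = 3]: the three sets are the sides of a triangle
    through the three elements of [P'], each with one further point, an element of
    [P].  Being one short of tight on the window, they exclude bad pairs, and a
    conflict can only exchange the point on a side for the opposite corner. *)
Lemma three_lines x y i j x2 y2 i2 j2 :
  witness x y i j -> y \in H i -> y \in H j ->
  witness x2 y2 i2 j2 -> y2 \in H i2 -> y2 \in H j2 ->
  y2 \notin H i -> y \notin H i2 ->
  {in P & P', forall a z, ~~ bad W a z} /\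
  (forall a b z, conflict P P' Q a z -> conflict P P' Q b z -> a = b).
Proof.
move=> w yi yj w2 y2i2 y2j2 y2i yi2.
have yP := wit_y w; have y2P := wit_y w2.
have vi := wit_Vi w; have vj := wit_Vj w; have vi2 := wit_Vi w2.
have yy2 : y2 != y by apply: contraNneq y2i => ->.
have i_i2 : i != i2 by apply: contraNneq y2i => ->.
have i_j2 : i != j2 by apply: contraNneq y2i => ->.
have inHi z : z \in P' -> z != y2 -> z \in H i.
  move=> zP zy2; apply: contraT => zi.
  by case: (missed_pair_neq w2 vi zP zi zy2) => e; move: i_i2 i_j2; rewrite e eqxx.
have i2_j : i2 != j by apply: contraNneq yi2 => ->.
have i2_i : i2 != i by rewrite eq_sym.
have inHi2 z : z \in P' -> z != y -> z \in H i2.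
  move=> zP zy; apply: contraT => zi.
  by case: (missed_pair_neq w vi2 zP zi zy) => e; move: i2_i i2_j; rewrite e eqxx.
have y2j : y2 \in H j.
  apply: contraR (wit_neq w) => y2j.
  by rewrite (missed_unique fV vi vj (P'_V _ y2P) y2i y2j).
have disj a m1 m2 : a \in P -> tight V m1 -> tight V m2 -> m1 != m2 ->
    a \in H m1 -> a \notin H m2.
  move=> aP t1 t2 m12 a1; apply: contra m12 => a2.
  by rewrite (hit_unique fV t1 t2 (P_notV st aP) a1 a2).
have p2 : #|P' :\ y :\ y2| + 2 = p.
  have := cardsD1 y P'; have := cardsD1 y2 (P' :\ y).
  rewrite !inE yP y2P yy2 (card_P' st) => -> ->; by rewrite addnA addnC.
have ci : #|P' :\ y :\ y2| <= #|P :&: H i|.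
  rewrite (card_D1I _ (wit_x w)) (wit_cardi w); apply: leq_trans (leq_addl _ _).
  apply: subset_leq_card; apply/subsetP => z; rewrite !inE => /and3P[zy2 zy zP].
  by rewrite zy zP inHi.
have ci2 : #|P' :\ y :\ y2| <= #|P :&: H i2|.
  rewrite (card_D1I _ (wit_x w2)) (wit_cardi w2); apply: leq_trans (leq_addl _ _).
  apply: subset_leq_card; apply/subsetP => z; rewrite !inE => /and3P[zy2 zy zP].
  by rewrite zy2 zP inHi2.
have cj : #|(P' :\ y) :&: H j| <= #|P :&: H j|.
  by rewrite (card_D1I _ (wit_x w)) (wit_cardj w) leq_addl.
have cj0 : 0 < #|(P' :\ y) :&: H j|.
  by rewrite card_gt0; apply/set0Pn; exists y2; rewrite !inE yy2 y2P y2j.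
have ctot : #|P :&: H i| + #|P :&: H i2| + #|P :&: H j| <= p.
  have d12 : [disjoint P :&: H i & P :&: H i2].
    rewrite disjoints_subset; apply/subsetP => a /setIP[aP ai].
    by rewrite !inE negb_and (disj a i i2) ?orbT.
  have d3 : [disjoint P :&: H i :|: P :&: H i2 & P :&: H j].
    rewrite disjoints_subset; apply/subsetP => a; rewrite !inE -andb_orr.
    case/andP=> aP /orP[] ai; rewrite negb_and.
      by rewrite (disj a i j) ?orbT // (wit_neq w).
    by rewrite (disj a i2 j) ?orbT.
  have := leq_card_setU (P :&: H i) (P :&: H i2).
  have := leq_card_setU (P :&: H i :|: P :&: H i2) (P :&: H j).
  move=> [_]; rewrite d3 => /eqP e3 [_]; rewrite d12 => /eqP e2.
  rewrite -e2 -e3 -(card_P st); apply: subset_leq_card.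
  by rewrite !subUset !subsetIl.
have p3 := witness_p w.
have [pE ai ai2 aj cjE] : [/\ p = 3, #|P :&: H i| = 1, #|P :&: H i2| = 1,
    #|P :&: H j| = 1 & #|(P' :\ y) :&: H j| = 1].
  by clear -p2 ci ci2 cj cj0 ctot p3; split; lia.
pose line m := [|| m == i, m == i2 | m == j].
have missed z : z \in P' -> exists m, line m && (z \notin H m).
  move=> zP; have [->|zy] := eqVneq z y.
    by exists i2; rewrite /line eqxx orbT yi2.
  have [->|zy2] := eqVneq z y2; first by exists i; rewrite /line eqxx y2i.
  exists j; rewrite /line eqxx !orbT /=.
  by rewrite -(wit_P' w zP zy) inHi.
have line_tight m : line m -> tight V m by case/or3P=> /eqP->.
have line1 m : line m -> #|P :&: H m| = 1 by case/or3P=> /eqP->.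
have line2 m : line m -> #|P' :&: H m| = 2.
  case/or3P=> /eqP->.
  - rewrite (_ : P' :&: H i = P' :\ y2).
      by have := cardsD1 y2 P'; rewrite y2P (card_P' st) pE => -[].
    apply/setP => z; rewrite !inE; have [->|zy] := eqVneq z y2.
      by rewrite (negPf y2i) andbF.
    by case: (boolP (z \in P')) => //= zP; rewrite inHi.
  - rewrite (_ : P' :&: H i2 = P' :\ y).
      by have := cardsD1 y P'; rewrite yP (card_P' st) pE => -[].
    apply/setP => z; rewrite !inE; have [->|zy] := eqVneq z y.
      by rewrite (negPf yi2) andbF.
    by case: (boolP (z \in P')) => //= zP; rewrite inHi2.
  by rewrite (card_D1I _ yP) cjE yj.
have slack m : line m -> #|W :&: H m| + 1 = h m.
  move=> lm; have := line_tight m lm; rewrite /tight (card_V st) (card_W st).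
  by rewrite line1 // line2 // => /eqP <-; rewrite addnC addnA.
have no_bad m a z : line m -> a \in P -> z \in P' -> a \notin H m ->
    z \in H m -> ~~ bad W a z.
  move=> lm aP zP am zm; have s := slack m lm.
  by apply: (slack_no_bad (m := m)) => //; rewrite -s ?addn1.
have all_lines m z : tight V m -> z \in P' -> z \notin H m -> line m.
  move=> vm zP zm; have [m' /andP[lm' zm']] := missed z zP.
  by rewrite (missed_unique fV vm (line_tight _ lm') (P'_V _ zP) zm zm').
split.
  move=> a z aP zP.
  have two m1 m2 : line m1 -> line m2 -> m1 != m2 -> z \in H m1 -> z \in H m2 ->
      ~~ bad W a z.
    move=> l1 l2 m12 z1 z2; have [a1|a1] := boolP (a \in H m1).
      by apply: (no_bad m2) => //; apply: disj a1 => //; apply: line_tight.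
    exact: (no_bad m1).
  have li : line i by rewrite /line eqxx.
  have li2 : line i2 by rewrite /line eqxx orbT.
  have lj : line j by rewrite /line eqxx !orbT.
  have [zy|zy] := eqVneq z y.
    by apply: (two i j); rewrite ?(wit_neq w) ?zy.
  have [zy2|zy2] := eqVneq z y2.
    by apply: (two i2 j); rewrite // zy2.
  by apply: (two i i2); rewrite ?inHi ?inHi2.
have out a z m m' : witness a z m m' -> a \notin H m.
  move=> wa; have [z' [z'P z'z z'm]] := wit_missi wa.
  have lm := all_lines m z' (wit_Vi wa) z'P z'm.
  apply/negP => am; have := line1 m lm; rewrite (card_D1I _ (wit_x wa)) am.
  case=> /eqP; rewrite (wit_cardi wa) cards_eq0 => /eqP/setP.
  have [z1 [z1P z1z z1m]] := wit_missj wa.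
  by move/(_ z1); rewrite !inE z1z z1P (wit_P' wa z1P z1z) z1m.
move=> a b z /conflict_witness[m1 [m2 wa]] /conflict_witness[m3 [m4 wb]].
exact: (conflict_column_unique wa wb (out _ _ _ _ wa) (out _ _ _ _ (witness_sym wa))
          (out _ _ _ _ wb) (out _ _ _ _ (witness_sym wb))).
Qed.

End Conflicts.

Section CompleteOrder.

Variable n : nat.
Hypothesis n_gt0 : 0 < n.

(** The step that preserves the invariant.  The three cases are those of the
    introduction: a conflict with [y] covered once, all conflicts sharing [y], and
    [three_lines]. *)
Lemma conflict_free_walk p (P Q : nat -> {set T}) : 0 < p ->
  (forall t, t <= n -> stage p (P t) (P t.+1) (Q t)) -> P n.+1 = P 0 ->
  ~~ splits (P n) (P n.+1) (bad (P n :|: Q n)) ->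
  exists2 w, closed_walk n P (fun t => bad (P t :|: Q t)) w &
             ~~ conflict (P n) (P n.+1) (Q n) (w n) (w n.+1).
Proof.
move=> p_gt0 st cyc nosplit.
pose b t := bad (P t :|: Q t).
have L t : t <= n -> link p (P t) (P t.+1) (b t) by move=> /st/stage_link.
have stn := st n (leqnn n); have card0 : #|P 0| = p by rewrite -cyc (card_P' stn).
have wcyc w : closed_walk n P b w -> w n.+1 = w 0 by case.
pose K := conflict (P n) (P n.+1) (Q n).
have [/existsP[x /existsP[y xy]]|none] := boolP [exists x, exists y, K x y];
  last first.
  have [||[w cw _]|near] := @closed_walk_or_near_split _ p n P b L n_gt0 cyc (P 0).
  - by [].
  - by rewrite card0; lia.
  - exists w => //; apply: contra none => kw.
    by apply/existsP; exists (w n); apply/existsP; exists (w n.+1).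
  have /negP[] := nosplit; apply: near_split_splits (L n (leqnn n)) _.
  by move: near; rewrite -cyc.
have [i [j w]] := conflict_witness stn nosplit xy.
have p3 := witness_p stn w.
have row_case x1 y1 i1 j1 : witness (P n) (P n.+1) (Q n) x1 y1 i1 j1 ->
    ~~ ((y1 \in H i1) && (y1 \in H j1)) ->
    exists2 w, closed_walk n P b w & ~~ K (w n) (w n.+1).
  move=> w1 v0.
  have [||[v cv vn]|near] :=
    @closed_walk_or_near_split_rev _ p n P b (P n :\ x1) L n_gt0 cyc.
  - exact: subD1set.
  - have := cardsD1 x1 (P n); rewrite (wit_x w1) (card_P stn).
    by clear -p3; lia.
  - exists v => //; apply: contraTN vn => /(conflict_row_unique stn nosplit w1 v0)->.
    by rewrite !inE eqxx.
  by case: (no_near_split_row stn nosplit w1 v0 near).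
have [/andP[yi yj]|v0] := boolP ((y \in H i) && (y \in H j)); last exact: row_case w v0.
have [/forallP same|] := boolP [forall x2, forall y2, K x2 y2 ==> (y2 == y)].
  have [||[v cv vn]|near] :=
    @closed_walk_or_near_split _ p n P b L n_gt0 cyc (P 0 :\ y).
  - exact: subD1set.
  - have := cardsD1 y (P 0); rewrite -cyc (wit_y w) (card_P' stn).
    by clear -p3; lia.
  - exists v => //; apply: contraTN vn => kv.
    have /forallP/(_ (v n.+1))/implyP/(_ kv)/eqP := same (v n).
    by rewrite (wcyc _ cv) => ->; rewrite !inE eqxx.
  by rewrite -cyc in near; case: (no_near_split_col stn nosplit w yi yj near).
rewrite negb_forall => /existsP[x2]; rewrite negb_forall => /existsP[y2].
rewrite negb_imply => /andP[xy2 y2y].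
have [i2 [j2 w2]] := conflict_witness stn nosplit xy2.
have [/andP[y2i2 y2j2]|v0] := boolP ((y2 \in H i2) && (y2 \in H j2));
  last exact: row_case w2 v0.
(* [three_lines] wants [y2] outside the first set of [x, y] and [y] outside the
   first set of [x2, y2], which is a matter of naming the sets. *)
have [nb func] : {in P n & P n.+1, forall a z, ~~ b n a z} /\
    (forall a a' z, K a z -> K a' z -> a = a').
  have lines i' j' : witness (P n) (P n.+1) (Q n) x y i' j' ->
      y \in H i' -> y \in H j' -> y2 \notin H i' ->
    {in P n & P n.+1, forall a z, ~~ b n a z} /\
    (forall a a' z, K a z -> K a' z -> a = a').
    move=> w' yi' yj' y2i'; have := wit_P' w2 (wit_y w); rewrite eq_sym y2y.
    case: (boolP (y \in H i2)) => yi2 /(_ isT); last first.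
      by move=> _; apply: (three_lines stn nosplit w' yi' yj' w2).
    move/esym=> yj2.
    exact: (three_lines stn nosplit w' yi' yj' (witness_sym w2)).
  have := wit_P' w (wit_y w2) y2y; case: (boolP (y2 \in H i)) => y2i yE.
    by apply: (lines j i); rewrite -?yE //; apply: witness_sym.
  exact: (lines i j).
have [z zP] := reach_two L n_gt0 p3.
case/card_gt1P=> a [a' [aR a'R aa']].
have zP1 : [set z] \subset P 0 by rewrite sub1set.
(* Of two elements that can precede [z], at most one is in conflict with it. *)
have [c [cR nK]] : exists c, c \in reach P b n [set z] /\ ~~ K c z.
  have [kz|nk] := boolP (K a z); last by exists a.
  exists a'; split=> //; apply: contra aa' => kz'.
  by rewrite (func _ _ _ kz kz').
have [v [[vP vb] /set1P v0 vn]] := reach_walk zP1 cR.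
exists (fun t => if t <= n then v t else z); last by rewrite leqnn ltnn vn.
split; last by rewrite ltnn v0.
split=> t.
  rewrite leq_eqVlt => /orP[/eqP->|]; first by rewrite ltnn cyc.
  by rewrite ltnS => tn; rewrite tn; apply: vP.
rewrite ltnS => tn; rewrite tn; case: ltnP => nt; first exact: vb.
have -> : t = n by apply/eqP; rewrite eqn_leq tn.
by apply: nb; [apply: vP|rewrite cyc].
Qed.

(** The steps of [conflict_free_walk] supply the orders element by element. *)
Lemma exchange_orders p (P Q : nat -> {set T}) :
  (forall t, t <= n -> stage p (P t) (P t.+1) (Q t)) -> P n.+1 = P 0 ->
  ~~ splits (P n) (P n.+1) (bad (P n :|: Q n)) ->
  exists s : nat -> seq T,
    [/\ s n.+1 = s 0, forall t, t <= n.+1 -> uniq (s t) /\ s t =i P t &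
        forall t j, t <= n ->
          fits ([set x in drop j (s t) ++ take j (s t.+1)] :|: Q t)].
Proof.
elim: p P Q => [|p IH] P Q st cyc nosplit.
  have P0 t : t <= n.+1 -> P t = set0.
    move=> tn; apply/eqP; rewrite -cards_eq0; case: t tn => [_|t tn].
      by rewrite (card_P (st 0 (leq0n n))).
    by rewrite (card_P' (st t tn)).
  exists (fun=> [::]); split=> // [t tn|t j tn].
    by split=> // x; rewrite P0 // inE.
  rewrite (_ : _ :|: _ = P t :|: Q t) ?(fits_old (st t tn)) //.
  by rewrite P0 1?ltnW // /=; congr (_ :|: _); apply/setP => x; rewrite !inE.
have [w [[wP wb] wcyc] nconf] := conflict_free_walk (ltn0Sn p) st cyc nosplit.
pose P' t := P t :\ w t; pose Q' t := w t.+1 |: Q t.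
have st' t : t <= n -> stage p (P' t) (P' t.+1) (Q' t).
  move=> tn; apply: (stage_move (st t tn)); rewrite ?wP ?wb //.
  exact: leqW.
have nosplit' : ~~ splits (P' n) (P' n.+1) (bad (P' n :|: Q' n)).
  apply: contra nconf => sp; apply/and4P; split; rewrite ?wP ?wb //.
have [|s [scyc sP sfit]] := IH P' Q' st' _ nosplit'.
  by rewrite /P' cyc wcyc.
exists (fun t => w t :: s t); split=> [|t tn|t j tn]; first by rewrite scyc wcyc.
  have [us sE] := sP t tn; split=> /=.
    by rewrite us sE !inE eqxx.
  move=> x; rewrite inE sE !inE; case: eqVneq => //= ->.
  by rewrite wP.
case: j => [|j].
  rewrite drop0 take0 cats0; have := fits_old (st t tn).
  congr (is_true (fits (_ :|: _))); apply/setP => x; rewrite inE.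
  have [_ sE] := sP t (leqW tn); rewrite inE sE !inE; case: eqVneq => //= ->.
  by rewrite wP // leqW.
have := sfit t j tn; congr (is_true (fits _)); apply/setP => x.
rewrite !inE /= !mem_cat /= ?inE; case: (x \in drop _ _) => //=.
by case: (x == w t.+1); rewrite ?orbT.
Qed.

End CompleteOrder.

(** By [pair_slack], if one set is tight on [X], no other bound can be exceeded. *)
Lemma fits_of_tight (X : {set T}) i : #|X| = r -> #|X :&: H i| = h i -> fits X.
Proof.
move=> Xr Xi; apply/andP; rewrite Xr; split=> //; apply/forallP => j.
have [<-|ij] := eqVneq i j; first by rewrite Xi.
have := pair_slack Xr ij; rewrite Xi -!addnA leq_add2l.
exact/leq_trans/leq_addr.
Qed.

Section AllSplit.

Variables (n : nat) (E : nat -> {set T}).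
Hypothesis fitE : forall t, fits (E t).
Hypothesis disjE : forall t, [disjoint E t & E t.+1].
Hypothesis splitE : forall t, t <= n -> splits (E t) (E t.+1) (bad (E t)).

Lemma stage0 t : stage r (E t) (E t.+1) set0.
Proof.
by split; rewrite ?setU0 ?fits_card ?fitE ?(fits_card (fitE _)) //;
  rewrite disjoint_sym -setI_eq0 set0I.
Qed.

(** The splitting sets of two consecutive links are all tight on the basis that the
    links share.  Every element of that basis is missed by a member of the first
    pair, so the second pair is the same. *)
Lemma common_tight : exists i, forall t, t <= n.+1 -> tight (E t) i.
Proof.
have sp t : t <= n -> exists i j, [/\ i != j,
    tight (E t) i && tight (E t) j,
    tight (E t.+1) i && tight (E t.+1) j,
    exists2 y, y \in E t.+1 & y \notin H i &
    exists2 y, y \in E t.+1 & y \notin H j].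
  move=> /splitE spt; have := splits_tightP (stage0 t).
  by rewrite !setU0 => /elimT; apply.
have missed_old t i : tight (E t) i -> tight (E t.+1) i ->
    (exists2 y, y \in E t.+1 & y \notin H i) ->
    exists2 y, y \in E t & y \notin H i.
  move=> /eqP ti /eqP ti' [y yE yi]; apply/subsetPn.
  apply: contra yi => /setIidPl EH; move: ti; rewrite EH => rE.
  have : E t.+1 :&: H i = E t.+1.
    apply/eqP; rewrite eqEcard subsetIl ti' -rE.
    by rewrite (fits_card (fitE _)) (fits_card (fitE t)) leqnn.
  by move/setP/(_ y); rewrite inE yE => /= ->.
have [i [j [ij t0 t1 _ _]]] := sp 0 (leq0n n).
have pair t : t <= n -> tight (E t) i && tight (E t) j &&
    (tight (E t.+1) i && tight (E t.+1) j).
  elim: t => [_|t IH tn]; first by rewrite t0 t1.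
  have /andP[/andP[oi oj] nij] := IH (ltnW tn).
  have /andP[ni nj] := nij.
  have [i' [j' [ij' /andP[ti tj] tij' mi mj]]] := sp _ tn.
  have old m : tight (E t.+1) m -> tight (E t.+2) m ->
      (exists2 y, y \in E t.+2 & y \notin H m) -> m = i \/ m = j.
    move=> t1m t2m /(missed_old _ _ t1m t2m)[y yE ym].
    have : ~~ ((y \in H i) && (y \in H j)).
      apply/negP => /andP[yi yj].
      have yE' := tight_capS (fitE t) ij oi oj yi yj.
      by rewrite (disjointFr (disjE t) yE') in yE.
    by rewrite negb_and => /orP[] ny; [left|right];
      apply: (missed_unique (fitE t.+1)) ny.
  have /andP[ti' tj'] := tij'.
  rewrite nij; move: ij' tij'.
  case: (old i' ti ti' mi) => ->; case: (old j' tj tj' mj) => ->; rewrite ?eqxx //.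
  by rewrite andbC.
exists i; case=> [|t] tn; first by have /andP[/andP[]] := pair 0 (leq0n n).
by have /andP[_ /andP[]] := pair t tn.
Qed.

End AllSplit.

(** The shift [d] serves to make a link that does not split the last one. *)
Lemma split_orders k (E : nat -> {set T}) : 0 < k ->
  (forall t, E (t + k) = E t) -> (forall t, fits (E t)) ->
  (1 < k -> forall t, [disjoint E t & E t.+1]) ->
  exists (d : nat) (s : nat -> seq T),
    [/\ s k = s 0, forall t, t <= k -> uniq (s t) /\ s t =i E (d + t) &
        forall t j, t < k ->
          fits [set x in drop j (s t) ++ take j (s t.+1)]].
Proof.
case: k => // -[|n] _ cyc fitE disjE.
  exists 0, (fun=> enum (E 0)); split=> // [t|t j _].
    rewrite enum_uniq; split=> // x; rewrite mem_enum.
    by move: t H0; do 2?case=> //; rewrite (cyc 0).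
  rewrite (_ : [set x in _] = E 0) //; apply/setP => x.
  by rewrite inE mem_cat orbC -mem_cat cat_take_drop mem_enum.
have {}disjE := disjE isT.
have [/existsP[t0 nosplit]|] :=
  boolP [exists t0 : 'I_n.+2, ~~ splits (E t0) (E t0.+1) (bad (E t0))].
  (* After this shift, the link that does not split has index [n.+1], the last. *)
  pose P t := E (t0.+1 + t).
  have Pn : P n.+1 = E t0 by rewrite /P addSnnS cyc.
  have Pn1 : P n.+2 = E t0.+1 by rewrite /P cyc.
  have stP t : t <= n.+1 -> stage r (P t) (P t.+1) set0.
    by move=> _; rewrite /P addnS; apply: stage0.
  have [||s [sc sP sf]] := exchange_orders (ltn0Sn n) stP.
  - by rewrite Pn1 /P addn0.
  - by rewrite Pn Pn1 setU0.
  by exists t0.+1, s; split=> // t j tn; have := sf t j tn; rewrite setU0.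
rewrite negb_exists => /forallP allsplit.
have [|i ti] := common_tight (n := n.+1) fitE disjE.
  by move=> t tn; have := allsplit (Ordinal (tn : t < n.+2)); rewrite negbK.
(* Every window meets [H i] in the first parts of two consecutive blocks. *)
pose S b := if b then H i else ~: H i.
pose c t b := enum (E t :&: S b).
pose s t := flatten [seq c t b | b <- [:: true; false]].
have sE t : s t =i E t.
  by move=> x; rewrite /s /= cats0 mem_cat !mem_enum !inE -andb_orr orbN andbT.
have dS b b' x : x \in S b -> x \in S b' -> b = b'.
  by rewrite /S; case: b; case: b' => //; rewrite inE; case: (x \in H i).
have cS t b : b \in [:: true; false] -> {subset c t b <= S b}.
  by move=> _ x; rewrite mem_enum inE => /andP[].
have us t : uniq (s t).
  apply: uniq_flatten_blocks => // [b _|b b' x _ _]; first exact: enum_uniq.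
  by rewrite !mem_enum !inE => /andP[_ xb] /andP[_]; apply: dS.
have sz t : size (s t) = r.
  by rewrite -(card_uniqP (us t)) (eq_card (sE t)) (fits_card (fitE t)).
exists 0, s; split=> [|t tn|t j tn]; rewrite ?add0n //.
  by rewrite /s /c (cyc 0).
have szc t' b : t' <= n.+2 -> size (c t' b) = if b then h i else r - h i.
  move=> t'n; rewrite -cardE; have /eqP hi := ti t' t'n.
  case: b; first exact: hi.
  have := cardsID (H i) (E t'); rewrite (fits_card (fitE t')) hi -setDE => <-.
  by rewrite addKn.
have uw : uniq (drop j (s t) ++ take j (s t.+1)).
  apply: uniq_window => //; right.
  by rewrite (eq_disjoint (sE t)) (eq_disjoint_r (sE t.+1)).
apply: (@fits_of_tight _ i).
  by rewrite cardsE (card_uniqP uw) size_window ?sz.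
have [i' iE] := filter_window_blocks (isT : uniq [:: true; false])
  (fun b _ => etrans (szc t b (ltnW tn)) (esym (szc t.+1 b tn)))
  (cS t) (cS t.+1) dS j (isT : true \in [:: true; false]).
rewrite card_window // iE size_window ?szc // ltnW //.
Qed.

End SplitFamily.

(** * Direct sums *)

Lemma bases_direct_sum (T : finType) m (N : 'I_m -> matroid T) (M : matroid T) :
  direct_sum N M -> forall X : {set T},
  reflect (X \subset ground M /\ forall l, X :&: ground (N l) \in bases (N l))
          (X \in bases M).
Proof.
case=> dN gM bM X; rewrite bM; apply: (iffP imsetP) => [[F]|[XM XN]].
  rewrite inE => /forallP FN ->.
  have FS l : F l \subset ground (N l) by apply: bases_sub_ground.
  split=> [|l].
    by rewrite gM; apply/bigcupsP => l _; apply: subset_trans (FS l) (bigcup_sup l _).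
  rewrite (_ : _ :&: _ = F l) //; apply/setP => x; rewrite inE.
  apply/andP/idP => [[/bigcupP[l' _ xl'] xl]|xl]; last first.
    by split; [apply/bigcupP; exists l|apply: (subsetP (FS l))].
  have [<-//|ll'] := eqVneq l' l.
  by have := disjointFr (dN _ _ ll') (subsetP (FS l') _ xl'); rewrite xl.
exists [ffun l => X :&: ground (N l)].
  by rewrite inE; apply/forallP => l; rewrite ffunE.
apply/setP => x; apply/idP/bigcupP => [xX|[l _]]; last first.
  by rewrite ffunE => /setIP[].
have := subsetP XM x xX; rewrite gM => /bigcupP[l _ xl].
by exists l; rewrite // ffunE inE xX.
Qed.

Lemma mod_shift_surj k d i : i < k -> exists2 t, t < k & (d + t) %% k = i.
Proof.
move=> ik; have k0 : 0 < k by apply: leq_ltn_trans ik.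
have dk : d %% k <= k by rewrite ltnW // ltn_mod.
exists ((i + (k - d %% k)) %% k); first by rewrite ltn_mod.
by rewrite modnDmr -modnDml addnCA subnKC // modnDr modn_small.
Qed.

Lemma mod_shift_inj k d t t' : t < k -> t' < k ->
  (d + t) %% k = (d + t') %% k -> t = t'.
Proof.
move=> tk t'k /eqP; rewrite eqn_modDl !modn_small //.
by move/eqP.
Qed.

Theorem theorem1 (T : finType) (M : matroid T) (k : nat)
    (B : 'I_k -> {set T}) :
  split_matroid M ->
  1 <= k ->
  (forall i, B i \in bases M) ->
  (forall i j, i != j -> [disjoint B i & B j]) ->
  \bigcup_i B i = ground M ->
  exists s : seq T,
    cyclic_ordering M s /\ (forall i, cyclic_interval s (B i)).
Proof.
case=> m [N [[r [q [H [h [rS HS pair_le _ bE]]]]] unifN dsum]] k_gt0 BM dB BU.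
case: k B k_gt0 BM dB BU => // k' B _ BM dB BU; set k := k'.+1 in B BM dB BU *.
have basesP := bases_direct_sum dsum; have [dN gM _] := dsum.
pose S l := ground (N l).
have dS l l' x : x \in S l -> x \in S l' -> l = l'.
  move=> xl xl'; apply/eqP; apply: contraT => ll'.
  by rewrite -(disjointFr (dN _ _ ll') xl).
(* Indices are unfolded to the naturals, so that the shift [d] costs nothing. *)
pose C t := B (inord (t %% k)).
have CM t : C t \in bases M := BM _.
have Csub t : C t \subset ground M := bases_sub_ground (CM t).
have CN t l : C t :&: S l \in bases (N l) by have /basesP[_] := CM t; apply.
have Ccyc t : C (t + k) = C t by rewrite /C modnDr.
have dC t t' x : x \in C t -> x \in C t' -> t %% k = t' %% k.
  have inK a : nat_of_ord (inord (a %% k) : 'I_k) = a %% k.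
    by rewrite inordK // ltn_mod.
  move=> xt xt'; rewrite -(inK t) -(inK t'); congr (nat_of_ord _); apply/eqP.
  by apply: contraT => /dB/disjointFr/(_ xt); rewrite xt'.
have fitC t : fits r H h (C t :&: S ord0).
  have := CN t ord0; rewrite bE inE => /and3P[_ c f].
  by apply/andP.
have [|k1 t|d [s [scyc sP sfit]]] :=
  @split_orders T q r H h pair_le k (fun t => C t :&: S ord0) isT _ fitC.
- by move=> t /=; rewrite Ccyc.
- rewrite -setI_eq0; apply/eqP/setP => x; rewrite !inE.
  apply/negP => /andP[/andP[xt _] /andP[xt1 _]].
  have /eqP := dC _ _ _ xt xt1.
  by rewrite -(addn0 t) -addnS eqn_modDl mod0n modn_small.
pose c t l := if l == ord0 then s t else enum (C (d + t) :&: S l).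
have cP t l : t <= k -> uniq (c t l) /\ c t l =i C (d + t) :&: S l.
  move=> tk; rewrite /c; case: eqP => [->|_]; first exact: sP.
  by rewrite enum_uniq; split=> // x; rewrite mem_enum.
pose u t := flatten [seq c t l | l <- enum 'I_m.+1].
have uP t : t <= k -> uniq (u t) /\ u t =i C (d + t).
  move=> tk; split=> [|x].
    apply: uniq_flatten_blocks; first exact: enum_uniq.
      by move=> l _; have [] := cP t l tk.
    move=> l l' x _ _; rewrite (cP t l tk).2 (cP t l' tk).2 !inE.
    by case/andP=> _ xl /andP[_]; apply: dS.
  apply/flatten_mapP/idP => [[l _]|xC].
    by rewrite (cP t l tk).2 => /setIP[].
  have := subsetP (Csub _) x xC; rewrite gM => /bigcupP[l _ xl].
  by exists l; rewrite ?mem_enum // (cP t l tk).2 inE xC.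
have szu t : t <= k -> size (u t) = rank M.
  move=> tk; have [us uE] := uP t tk.
  by rewrite -(card_uniqP us) (eq_card uE) (card_basis (CM _)).
have ucyc : u k = u 0.
  by rewrite /u; congr flatten; apply: eq_map => l; rewrite /c scyc addn0 Ccyc.
have szc t l : t < k -> size (c t l) = size (c t.+1 l).
  move=> tk; have [us uE] := cP t l (ltnW tk); have [us' uE'] := cP t.+1 l tk.
  rewrite -(card_uniqP us) -(card_uniqP us') (eq_card uE) (eq_card uE').
  by rewrite !(card_basis (CN _ l)).
pose w t j := drop j (u t) ++ take j (u t.+1).
have w_basis t j : t < k -> [set x in w t j] \in bases M.
  move=> tk; have tk' := ltnW tk.
  apply/basesP; split=> [|l].
    apply/subsetP => x; rewrite inE mem_cat => /orP[/mem_drop|/mem_take].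
      by rewrite (uP t tk').2; apply: (subsetP (Csub _)).
    by rewrite (uP t.+1 tk).2; apply: (subsetP (Csub _)).
  have [||||i iE] := filter_window_blocks (S := S) (c := c t) (c' := c t.+1)
     (enum_uniq 'I_m.+1) _ _ _ dS j (l := l).
  - by move=> l' _; apply: szc.
  - by move=> l' _ x; rewrite (cP t l' tk').2 => /setIP[].
  - by move=> l' _ x; rewrite (cP t.+1 l' tk).2 => /setIP[].
  - by rewrite mem_enum.
  have sE : [set x in w t j] :&: S l = [set x in drop i (c t l) ++ take i (c t.+1 l)].
    by rewrite -iE; apply/setP => x; rewrite !inE mem_filter andbC.
  have uw : uniq (w t j).
    apply: uniq_window; [exact: (uP t tk').1|exact: (uP t.+1 tk).1|].
    have [k1|k1] := posnP k'.
      left; have t0 : t = 0 by move: tk; rewrite /k k1; case: (t).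
      by rewrite t0 -ucyc /k k1.
    right; rewrite disjoint_has; apply/hasPn => x.
    rewrite (uP t tk').2 /= (uP t.+1 tk).2 => xt; apply/negP => xt1.
    have /eqP := dC _ _ _ xt xt1; rewrite addnS -addn1 -{1}(addn0 (d + t)).
    by rewrite eqn_modDl mod0n modn_small.
  have [l0|l0] := eqVneq l ord0.
    rewrite l0 in sE *; rewrite bE inE sE.
    have := sfit t i tk; rewrite /fits /c eqxx => /andP[-> ->].
    rewrite !andbT -sE; exact: subsetIr.
  have [rl _ lE] := unifN l l0; rewrite lE inE subsetIr /=.
  rewrite card_window // iE size_window; last exact: szc.
  have [us uE] := cP t l tk'; rewrite -(card_uniqP us) (eq_card uE).
  by have := CN (d + t) l; rewrite lE inE => /andP[].
pose o := flatten [seq u t | t <- iota 0 k].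
have oE : o =i ground M.
  move=> x; apply/flatten_mapP/idP => [[t]|xM].
    rewrite mem_iota => /andP[_ tk]; rewrite (uP t (ltnW tk)).2.
    exact: (subsetP (Csub _)).
  move: xM; rewrite -BU => /bigcupP[i _ xi].
  have [t tk ti] := mod_shift_surj d (ltn_ord i).
  by exists t; rewrite ?mem_iota // (uP t (ltnW tk)).2 /C ti inord_val.
have segE t j : t < k -> j <= rank M ->
    cyclic_segment o (t * rank M + j) (rank M) = [set x in w t j].
  move=> tk jr; rewrite /cyclic_segment take_rot_blocks // => t' t'k.
  exact/szu/ltnW.
exists o; split; first split=> //.
- apply: uniq_flatten_blocks; first exact: iota_uniq.
    by move=> t; rewrite mem_iota => /andP[_ /ltnW/uP[]].
  move=> t t' x; rewrite !mem_iota => /andP[_ tk] /andP[_ t'k].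
  rewrite (uP t (ltnW tk)).2 (uP t' (ltnW t'k)).2 => xt xt'.
  exact: (mod_shift_inj tk t'k (dC _ _ _ xt xt')).
- have szo : size o = k * rank M.
    rewrite size_flatten (_ : shape _ = [seq rank M | _ <- iota 0 k]).
      by rewrite sumnE big_map big_const_seq count_predT size_iota iter_addn_0 mulnC.
    rewrite /shape -map_comp; apply/eq_in_map => t.
    by rewrite mem_iota => /andP[_ tk] /=; apply/szu/ltnW.
  move=> i; rewrite szo => ik.
  have r0 : 0 < rank M by move: ik; case: (rank M) => //; rewrite muln0.
  have tk : i %/ rank M < k by rewrite ltn_divLR.
  rewrite (divn_eq i (rank M)) segE // ?w_basis //.
  by rewrite ltnW // ltn_mod.
move=> i; have [t tk ti] := mod_shift_surj d (ltn_ord i).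
exists (t * rank M + 0), (rank M); rewrite segE // /w drop0 take0 cats0.
by apply/setP => x; rewrite inE (uP t (ltnW tk)).2 /C ti inord_val.
Qed.
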